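(* Let $a\in\mathbb{C}$ with $\Re(a)>1$ and let $h,k$ be positive coprime integers. Then for any $\epsilon$ with $0<\epsilon<\min\left\{ \frac{1}{h},\frac{1}{k}\right\}$, \[ h^{1-a} \, c_{-a}\left(\frac{h}{k}\right)+k^{1-a} \, c_{-a}\left(\frac{k}{h}\right) \ = \ \frac{a \, \zeta(a+1)}{\pi(hk)^{a}}-\frac{(hk)^{1-a}}{2i}\int_{(\epsilon)}\frac{\cot(\pi hz)\cot(\pi kz)}{z^{a}} \, dz \, . \]
   Context: For $s\in\mathbb{C}$ with $\Re(s)>1$ and $\Re(x)>0$, $\zeta(s,x)=\sum_{n\ge0}(n+x)^{-s}$ is the Hurwitz zeta function (meromorphically continued in $s$), and $\zeta(s)=\zeta(s,1)$ is the Riemann zeta function. For $b\in\mathbb{C}$ and positive coprime integers $h,k$, the Bettin--Conrey sum is \[ c_{b}\left(\frac{h}{k}\right)=k^{b}\sum_{m=1}^{k-1}\cot\left(\frac{\pi mh}{k}\right)\zeta\left(-b,\frac{m}{k}\right), \] so in particular $c_{-a}(h/k)=k^{-a}\sum_{m=1}^{k-1}\cot(\pi mh/k)\,\zeta(a,m/k)$. The notation $\int_{(\epsilon)}$ denotes integration along the vertical line $\Re(z)=\epsilon$, oriented upward (from $\epsilon-i\infty$ to $\epsilon+i\infty$), and $z^{-a}$ uses the principal branch. *)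

(* Defs.v *)
From Stdlib Require Import Reals ClassicalEpsilon.
From Coquelicot Require Import Coquelicot.

Open Scope R_scope.

Definition Cexp (z : C) : C := (exp (Re z) * (cos (Im z), sin (Im z)))%C.

(* Principal argument, with values in (-PI, PI]; the value at 0 is irrelevant. *)
Definition Carg (z : C) : R :=
  if Rlt_dec 0 (Re z) then atan (Im z / Re z)
  else if Rlt_dec 0 (Im z) then PI / 2 - atan (Re z / Im z)
  else if Rlt_dec (Im z) 0 then - PI / 2 - atan (Re z / Im z)
  else PI.

Definition Clog (z : C) : C := (ln (Cmod z), Carg z).

(* Principal branch of z ^ s for z <> 0. [Cpow] and [^] from Coquelicot only
   have natural exponents. *)
Definition Cpower (z s : C) : C := Cexp (s * Clog z)%C.

Definition Ccos (z : C) : C := ((Cexp (Ci * z) + Cexp (- (Ci * z))) / 2)%C.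
Definition Csin (z : C) : C := ((Cexp (Ci * z) - Cexp (- (Ci * z))) / (2 * Ci))%C.
Definition Ccot (z : C) : C := (Ccos z / Csin z)%C.

Definition CSeries (u : nat -> C) : C :=
  (Series (fun n => Re (u n)), Series (fun n => Im (u n))).

Definition hurwitz_series (s x : C) : C :=
  CSeries (fun n => Cpower (INR n + x)%C (- s)%C).

(* The condition determines F uniquely on C minus {1}. *)
Definition hurwitz_continuation (x : C) (F : C -> C) : Prop :=
  (forall s : C, s <> RtoC 1 -> exists l : C, is_derive F s l) /\
  (forall s : C, 1 < Re s -> F s = hurwitz_series s x).

(* Hurwitz zeta function zeta(s, x) for Re x > 0: the series where it
   converges, the analytic continuation in s elsewhere (s <> 1). *)
Definition hurwitz_zeta (s x : C) : C :=
  if Rlt_dec 1 (Re s) then hurwitz_series s x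
  else epsilon (inhabits (fun _ : C => RtoC 0)) (hurwitz_continuation x) s.

Definition zeta (s : C) : C := hurwitz_zeta s 1.

(* Bettin-Conrey sum c_b(h/k); h and k are meant to be positive and coprime.
   For k = 1 the sum is empty, [sum_n_m] being zero on the range 1..0. *)
Definition bettin_conrey (b : C) (h k : nat) : C :=
  (Cpower (INR k) b *
   sum_n_m (fun m : nat =>
     Ccot (PI * INR m * INR h / INR k)%R * hurwitz_zeta (- b) (INR m / INR k)%R)
     1 (k - 1))%C.

(* Parametrization y |-> c + i y, so that dz = i dy, on the line Re z = c. *)
Definition vline_integrand (f : C -> C) (c : R) (y : R) : C := (Ci * f (c, y))%C.

Definition ex_vline_int (f : C -> C) (c : R) : Prop :=
  ex_RInt_gen (V := C_R_NormedModule) (vline_integrand f c)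
    (Rbar_locally m_infty) (Rbar_locally p_infty).

Definition vline_int (f : C -> C) (c : R) : C :=
  RInt_gen (V := C_R_CompleteNormedModule) (vline_integrand f c)
    (Rbar_locally m_infty) (Rbar_locally p_infty).

(* Main.v *)
(* The function cot(pi h z) cot(pi k z) is 1-periodic and is a finite linear
   combination of 1, csc(pi z)^2 and the translates cot(pi (z - m/k)),
   cot(pi (z - m/h)), the coefficients being the values cot(pi m h/k) and
   cot(pi m k/h) (from cot A cot B = cot(A - B) (cot B - cot A) - 1 and the
   multiplication formula of the cotangent). It remains to integrate each term
   against z^(-a). Shifting the line Re z = eps to the right by 1 across the
   simple pole p + n of cot(pi (z - p)) changes the integral by a multiple of
   (p + n)^(-a), and the integral over Re z = eps + N tends to 0, whence the
   Hurwitz zeta value zeta(a, p). The term csc^2 reduces to zeta(a + 1) by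
   parts, and the term 1 contributes 0.

   The line is shifted by differentiating the integral over a vertical segment
   with respect to its abscissa: by the Cauchy-Riemann equations only boundary
   terms remain. To cross the pole q one replaces z^(-a) by z^(-a) - q^(-a),
   which makes the singularity bounded and, by periodicity of the cotangent,
   does not change the difference of the two integrals. *)
Require Import Defs.
From Stdlib Require Import Reals Lra Lia Arith ZArith.
From Coquelicot Require Import Coquelicot.

Open Scope R_scope.

(** * Complex exponential and trigonometric functions *)

(** The bound on [eps] puts all the poles m/k and m/h of the simple terms, and the pole 1 used for
    the csc^2 term, strictly between the lines Re z = eps and Re z = eps + 1. So each series of
    residues starts at n = 0 and gives exactly zeta(a, p). The identity for cot A cot B breaks down
    at the common pole 0, and that exception produces the csc^2 term. No residue is computed by a
    loop. After q^(-a) is subtracted, the integrand is close to i q^(-a) at the top of a long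
    segment and to -i q^(-a) at the bottom; these boundary values make the integral in y grow at
    rate about 2 q^(-a) in the abscissa, over a width of 1. The exponent is split as Re a = kappa +
    tau with kappa > 0 and tau > 1, which Re a > 1 allows: tau makes the integrals converge, kappa
    makes them vanish as the line moves right. Existence of the improper integral is obtained once,
    for the whole integrand, from its decay. Its value is computed term by term on symmetric
    segments [-T, T], where limits in one parameter suffice. *)

Lemma C_ext (z w : C) : Re z = Re w -> Im z = Im w -> z = w.
Proof. destruct z, w; simpl; intros; subst; reflexivity. Qed.

Lemma RtoC_neq (x : R) : x <> 0 -> RtoC x <> RtoC 0.
Proof. intros H E. apply H. now injection E. Qed.

Lemma Ci_neq0 : Ci <> RtoC 0.
Proof. intros E. injection E. lra. Qed.

Lemma Ci_sqr : (Ci * Ci = - (1))%C.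
Proof. apply C_ext; simpl; ring. Qed.

Lemma Cexp_alt (z : C) :
  Cexp z = (exp (Re z) * cos (Im z), exp (Re z) * sin (Im z)).
Proof. unfold Cexp. apply C_ext; simpl; ring. Qed.

Lemma Cexp_plus (z w : C) : Cexp (z + w)%C = (Cexp z * Cexp w)%C.
Proof.
  rewrite !Cexp_alt; destruct z as [x y], w as [u v]; simpl.
  rewrite exp_plus, cos_plus, sin_plus. apply C_ext; simpl; ring.
Qed.

Lemma Cexp_0 : Cexp 0 = 1%C.
Proof.
  rewrite Cexp_alt; simpl. rewrite exp_0, cos_0, sin_0. apply C_ext; simpl; ring.
Qed.

Lemma Cmod_Cexp (z : C) : Cmod (Cexp z) = exp (Re z).
Proof.
  assert (H : exp (Re z) * exp (Re z) = Cmod (Cexp z) ^ 2).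
  { rewrite Cmod2_alt, Cexp_alt. unfold Re, Im; simpl.
    generalize (sin2_cos2 (snd z)). unfold Rsqr. intros H. nra. }
  generalize (exp_pos (Re z)), (Cmod_ge_0 (Cexp z)). nra.
Qed.

Lemma Cexp_neq0 (z : C) : Cexp z <> 0%C.
Proof. intros E. generalize (Cmod_Cexp z). rewrite E, Cmod_0. generalize (exp_pos (Re z)). lra. Qed.

Lemma Cexp_opp (z : C) : Cexp (- z)%C = (/ Cexp z)%C.
Proof.
  assert (H : (Cexp z * Cexp (- z) = 1)%C).
  { rewrite <- Cexp_plus, Cplus_opp_r. apply Cexp_0. }
  rewrite <- (Cmult_1_l (Cexp (- z))), <- (Cinv_l (Cexp z)) by apply Cexp_neq0.
  rewrite <- Cmult_assoc, H. ring.
Qed.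

Lemma Cexp_natmul (n : nat) (z : C) : Cexp (INR n * z)%C = (Cexp z ^ n)%C.
Proof.
  induction n as [|n IH].
  - simpl. rewrite Cmult_0_l. apply Cexp_0.
  - rewrite S_INR, RtoC_plus, Cmult_plus_distr_r, Cexp_plus, IH, Cmult_1_l.
    simpl. ring.
Qed.

Lemma Csin_alt (x y : R) : Csin (x, y) = (sin x * cosh y, cos x * sinh y).
Proof.
  unfold Csin. rewrite !Cexp_alt; simpl. unfold cosh, sinh.
  replace (0 * x - 1 * y) with (- y) by ring.
  replace (0 * y + 1 * x) with x by ring.
  rewrite Ropp_involutive, cos_neg, sin_neg.
  apply C_ext; simpl; field.
Qed.

Lemma Ccos_alt (x y : R) : Ccos (x, y) = (cos x * cosh y, - sin x * sinh y).
Proof.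
  unfold Ccos. rewrite !Cexp_alt; simpl. unfold cosh, sinh.
  replace (0 * x - 1 * y) with (- y) by ring.
  replace (0 * y + 1 * x) with x by ring.
  rewrite Ropp_involutive, cos_neg, sin_neg.
  apply C_ext; simpl; field.
Qed.

Lemma cosh_sqr (y : R) : cosh y ^ 2 = 1 + sinh y ^ 2.
Proof.
  unfold cosh, sinh. assert (H : exp y * exp (- y) = 1).
  { rewrite <- exp_plus, Rplus_opp_r. apply exp_0. }
  nra.
Qed.

Lemma sin_sqr (x : R) : sin x ^ 2 = 1 - cos x ^ 2.
Proof. generalize (sin2_cos2 x). unfold Rsqr. lra. Qed.

Lemma Cmod_Csin_sqr (x y : R) : Cmod (Csin (x, y)) ^ 2 = sin x ^ 2 + sinh y ^ 2.
Proof.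
  rewrite Csin_alt, Cmod2_alt. unfold Re, Im; simpl fst; simpl snd.
  rewrite !Rpow_mult_distr, cosh_sqr, sin_sqr. ring.
Qed.

Lemma Cmod_Ccos_sqr (x y : R) : Cmod (Ccos (x, y)) ^ 2 = cos x ^ 2 + sinh y ^ 2.
Proof.
  rewrite Ccos_alt, Cmod2_alt. unfold Re, Im; simpl fst; simpl snd.
  rewrite !Rpow_mult_distr, cosh_sqr.
  replace ((- sin x) ^ 2) with (sin x ^ 2) by ring. rewrite sin_sqr. ring.
Qed.

Lemma sinh_ge (y : R) : 0 <= y -> y <= sinh y.
Proof.
  intros Hy. destruct (Req_dec y 0) as [->|H].
  - rewrite sinh_0; lra.
  - destruct (MVT_gen sinh 0 y cosh) as [c [_ Hc]].
    + intros t _. apply is_derive_Reals, derivable_pt_lim_sinh.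
    + intros t _. apply derivable_continuous_pt, derivable_pt_sinh.
    + rewrite sinh_0 in Hc.
      assert (1 <= cosh c).
      { generalize (cosh_sqr c). assert (0 < cosh c) by (unfold cosh; generalize (exp_pos c), (exp_pos (- c)); lra). nra. }
      nra.
Qed.

Lemma sinh_sqr_ge (y : R) : y ^ 2 <= sinh y ^ 2.
Proof.
  destruct (Rle_dec 0 y) as [H|H].
  - generalize (sinh_ge y H); nra.
  - assert (H' : 0 <= - y) by lra. generalize (sinh_ge (- y) H').
    replace (sinh (- y)) with (- sinh y) by (unfold sinh; rewrite Ropp_involutive; lra). nra.
Qed.

Lemma Csin_neq0 (x y : R) : sin x <> 0 \/ y <> 0 -> Csin (x, y) <> 0%C.
Proof.
  intros H E. generalize (Cmod_Csin_sqr x y). rewrite E, Cmod_0.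
  generalize (sinh_sqr_ge y). destruct H as [H|H]; nra.
Qed.

(** Makes the zeros of the sine the solutions of exp(2iu) = 1, so that the cotangent becomes a
    rational function of exp(2iu) and its identities become identities of fractions. *)
Lemma Cexp2_minus_1 (u : C) :
  (Cexp (2 * Ci * u) - 1 = 2 * Ci * Cexp (Ci * u) * Csin u)%C.
Proof.
  unfold Csin. rewrite Cexp_opp.
  replace (2 * Ci * u)%C with (Ci * u + Ci * u)%C by ring.
  rewrite Cexp_plus. field. repeat split; try apply Cexp_neq0; try apply Ci_neq0; try (apply RtoC_neq; lra).
Qed.

Lemma Cexp2_neq1 (u : C) : Csin u <> 0%C <-> Cexp (2 * Ci * u)%C <> 1%C.
Proof.
  split; intros H E.
  - assert (E' : (2 * Ci * Cexp (Ci * u) * Csin u = 0)%C).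
    { rewrite <- Cexp2_minus_1, E. ring. }
    revert E'. apply Cmult_neq_0; [apply Cmult_neq_0; [apply Cmult_neq_0|]|exact H].
    apply RtoC_neq; lra. apply Ci_neq0. apply Cexp_neq0.
  - apply H. replace (Cexp (2 * Ci * u)) with ((Cexp (2 * Ci * u) - 1) + 1)%C by ring.
    rewrite Cexp2_minus_1, E. ring.
Qed.

Lemma Cminus_neq0 (z w : C) : z <> w -> (z - w)%C <> 0%C.
Proof. intros H E. apply H. replace z with ((z - w) + w)%C by ring. rewrite E. ring. Qed.

Lemma Ccot_Cexp (u : C) : Csin u <> 0%C ->
  Ccot u = (Ci + 2 * Ci / (Cexp (2 * Ci * u) - 1))%C.
Proof.
  intros H. rewrite Cexp2_minus_1.
  assert (H' : (Ccos u = (Cexp (Ci * u) ^ 2 + 1) / (2 * Cexp (Ci * u)))%C).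
  { unfold Ccos. rewrite Cexp_opp. field. apply Cexp_neq0. }
  assert (H2 : (Cexp (Ci * u) ^ 2 = 1 + 2 * Ci * Cexp (Ci * u) * Csin u)%C).
  { rewrite <- Cexp2_minus_1. replace (2 * Ci * u)%C with (Ci * u + Ci * u)%C by ring.
    rewrite Cexp_plus. simpl. ring. }
  unfold Ccot. rewrite H', H2.
  field. repeat split; auto using Cexp_neq0, Ci_neq0.
Qed.

Lemma Csin_opp (u : C) : Csin (- u)%C = (- Csin u)%C.
Proof.
  unfold Csin. replace (Ci * - u)%C with (- (Ci * u))%C by ring.
  replace (- - (Ci * u))%C with (Ci * u)%C by ring. field. apply Ci_neq0.
Qed.

Lemma Ccos_opp (u : C) : Ccos (- u)%C = Ccos u.
Proof.
  unfold Ccos. replace (Ci * - u)%C with (- (Ci * u))%C by ring.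
  replace (- - (Ci * u))%C with (Ci * u)%C by ring. field.
Qed.

Lemma Ccot_opp (u : C) : Csin u <> 0%C -> Ccot (- u)%C = (- Ccot u)%C.
Proof.
  intros H. unfold Ccot. rewrite Csin_opp, Ccos_opp. field. exact H.
Qed.

Lemma Csin_plus_PI (u : C) : Csin (u + PI)%C = (- Csin u)%C.
Proof.
  destruct u as [x y]. unfold Cplus; simpl. rewrite Rplus_0_r, !Csin_alt, neg_sin, neg_cos.
  apply C_ext; simpl; ring.
Qed.

Lemma Ccos_plus_PI (u : C) : Ccos (u + PI)%C = (- Ccos u)%C.
Proof.
  destruct u as [x y]. unfold Cplus; simpl. rewrite Rplus_0_r, !Ccos_alt, neg_sin, neg_cos.
  apply C_ext; simpl; ring.
Qed.

Lemma Cinv_opp (u : C) : (/ - u = - / u)%C.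
Proof.
  unfold Cinv, Copp; simpl. f_equal; unfold Rdiv;
  replace (- fst u * (- fst u * 1) + - snd u * (- snd u * 1)) with
   (fst u * (fst u * 1) + snd u * (snd u * 1)) by ring; ring.
Qed.

Lemma Ccot_plus_PI (u : C) : Ccot (u + PI)%C = Ccot u.
Proof.
  unfold Ccot, Cdiv. rewrite Csin_plus_PI, Ccos_plus_PI, Cinv_opp. ring.
Qed.

Lemma Ccot_plus_natPI (n : nat) (u : C) : Ccot (u + PI * INR n)%C = Ccot u.
Proof.
  induction n as [|n IH].
  - simpl. f_equal. ring.
  - rewrite <- IH, S_INR, RtoC_plus, <- (Ccot_plus_PI (u + PI * INR n)). f_equal. ring.
Qed.

Lemma Ccot_mult (u v : C) :
  Csin u <> 0%C -> Csin v <> 0%C -> Csin (u - v)%C <> 0%C ->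
  (Ccot u * Ccot v = Ccot (u - v) * (Ccot v - Ccot u) - 1)%C.
Proof.
  intros Hu Hv Huv. rewrite !Ccot_Cexp by assumption.
  apply Cexp2_neq1 in Hu. apply Cexp2_neq1 in Hv. apply Cexp2_neq1 in Huv.
  revert Huv. replace (2 * Ci * (u - v))%C with (2 * Ci * u + - (2 * Ci * v))%C by ring.
  rewrite Cexp_plus, Cexp_opp.
  set (X := Cexp (2 * Ci * u)) in *. set (Y := Cexp (2 * Ci * v)) in *. intros Huv.
  assert (HY : Y <> 0%C) by apply Cexp_neq0.
  assert (HXY : (X - Y)%C <> 0%C).
  { apply Cminus_neq0. intros E. apply Huv. rewrite E. now apply Cinv_r. }
  replace (X * / Y - 1)%C with ((X - Y) / Y)%C by (field; assumption).
  replace (2 * Ci / ((X - Y) / Y))%C with (2 * Ci * Y / (X - Y))%C by (field; auto).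
  apply Cminus_neq0 in Hu. apply Cminus_neq0 in Hv.
  (* [field] sees [Ci] as an indeterminate. The factor [Ci * Ci] is kept explicit in both normal
     forms, so that [Ci_sqr] can be used exactly once, between them. *)
  transitivity (Ci * Ci * ((X + 1) * (Y + 1)) / ((X - 1) * (Y - 1)))%C.
  - field; auto.
  - transitivity (Ci * Ci * ((X + Y) * (2 * (X - Y)))  / ((X - Y) * ((X - 1) * (Y - 1))) - 1)%C.
    2:{ field; auto. }
    rewrite Ci_sqr. field; auto.
Qed.

Lemma Ccos_sqr (u : C) : (Ccos u * Ccos u = 1 - Csin u * Csin u)%C.
Proof.
  destruct u as [x y]. rewrite Ccos_alt, Csin_alt.
  generalize (cosh_sqr y), (sin_sqr x). intros E1 E2. apply C_ext; simpl; nra.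
Qed.

Lemma Ccot_sqr (u : C) : Csin u <> 0%C -> (Ccot u * Ccot u = / (Csin u * Csin u) - 1)%C.
Proof.
  intros H. unfold Ccot.
  transitivity (Ccos u * Ccos u / (Csin u * Csin u))%C; [field; exact H|].
  rewrite Ccos_sqr. field. exact H.
Qed.

(** By this default value [Ccot 0] is 0, which lets the sums of cotangents of differences of poles
    include the common pole 0. *)
Lemma Cinv_0 : (/ 0 = 0)%C.
Proof. unfold Cinv, Rdiv; apply C_ext; simpl; ring. Qed.

(** * Finite sums of cotangents *)

#[local] Arguments INR : simpl never.

(** The lemmas on [sum_n_m] speak of operations of abstract structures; they are converted here once
    and for all to the operations of [C], on which [ring] works. *)
Definition Csum (u : nat -> C) (a b : nat) : C := sum_n_m u a b.

Lemma Csum_mult_l (c : C) (u : nat -> C) (a b : nat) :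
  Csum (fun m => c * u m)%C a b = (c * Csum u a b)%C.
Proof. exact (sum_n_m_mult_l (K := C_Ring) c u a b). Qed.

Lemma Csum_plus (u v : nat -> C) (a b : nat) :
  Csum (fun m => u m + v m)%C a b = (Csum u a b + Csum v a b)%C.
Proof. exact (sum_n_m_plus (G := C_AbelianMonoid) u v a b). Qed.

Lemma Csum_first (u : nat -> C) (n : nat) :
  Csum u 0 n = (u 0%nat + Csum u 1 n)%C.
Proof. exact (sum_Sn_m (G := C_AbelianMonoid) u 0 n (Nat.le_0_l n)). Qed.

Lemma Csum_last (u : nat -> C) (n : nat) :
  Csum u 0 (S n) = (Csum u 0 n + u (S n))%C.
Proof. exact (sum_n_Sm (G := C_AbelianMonoid) u 0 n (Nat.le_0_l (S n))). Qed.

Lemma Csum_ext (u v : nat -> C) (a b : nat) :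
  (forall m, (a <= m <= b)%nat -> u m = v m) -> Csum u a b = Csum v a b.
Proof. exact (sum_n_m_ext_loc (G := C_AbelianMonoid) u v a b). Qed.

Lemma Csum_S (u : nat -> C) (a b : nat) :
  Csum (fun m => u (S m)) a b = Csum u (S a) (S b).
Proof. exact (sum_n_m_S (G := C_AbelianMonoid) u a b). Qed.

Lemma Csum_switch (u : nat -> nat -> C) (m n : nat) :
  Csum (fun i => Csum (u i) 0 n) 0 m = Csum (fun j => Csum (fun i => u i j) 0 m) 0 n.
Proof. exact (sum_n_switch (G := C_AbelianMonoid) u m n). Qed.

Lemma Csum_one (u : nat -> C) (n : nat) : Csum u n n = u n.
Proof. exact (sum_n_n (G := C_AbelianMonoid) u n). Qed.

Lemma Csum_const (c : C) (n : nat) : Csum (fun _ => c) 0 n = (INR (S n) * c)%C.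
Proof.
  induction n as [|n IH].
  - rewrite Csum_one. rewrite INR_1. ring.
  - rewrite Csum_last, IH, (S_INR (S n)), RtoC_plus. ring.
Qed.

Lemma Csum_zero (u : nat -> C) (a b : nat) :
  (forall m, (a <= m <= b)%nat -> u m = 0%C) -> Csum u a b = 0%C.
Proof.
  intros H. rewrite (Csum_ext u (fun _ => 0%C)) by exact H.
  exact (sum_n_m_const_zero (G := C_AbelianMonoid) a b).
Qed.

Lemma Csum_rev (u : nat -> C) (n : nat) :
  Csum (fun m => u (n - m)%nat) 0 n = Csum u 0 n.
Proof.
  induction n as [|n IH].
  - rewrite !Csum_one. reflexivity.
  - rewrite (Csum_last u), (Csum_first _ (S n)), Nat.sub_0_r, <- IH, Cplus_comm. f_equal.
    symmetry. exact (Csum_S (fun m => u (S n - m)%nat) 0 n).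
Qed.

Lemma Csum_geom (x : C) (n : nat) :
  ((x - 1) * Csum (fun j => x ^ j)%C 0 n = x ^ (S n) - 1)%C.
Proof.
  induction n as [|n IH].
  - rewrite Csum_one. simpl. ring.
  - rewrite Csum_last, Cmult_plus_distr_l, IH. simpl. ring.
Qed.

Lemma sin_neq0_not_divide (a b : Z) :
  b <> 0%Z -> ~ (b | a)%Z -> sin (PI * IZR a / IZR b) <> 0.
Proof.
  intros Hb Hd E. apply sin_eq_0_0 in E. destruct E as [j E]. apply Hd. exists j.
  apply eq_IZR. rewrite mult_IZR. apply eq_IZR_contrapositive in Hb.
  generalize PI_neq0; intros Hp.
  apply (Rmult_eq_reg_l PI); [|exact Hp].
  apply (Rmult_eq_compat_r (IZR b)) in E.
  replace (PI * IZR a / IZR b * IZR b) with (PI * IZR a) in E by (field; exact Hb). lra.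
Qed.

(* The argument pi m / k for the denominator k = n + 1. *)
Definition root_arg (n m : nat) : R := PI * INR m / INR (S n).

(** Orthogonality of the characters of Z/k with k = n + 1: for 0 < j < k the terms are the powers of
    w = exp(-2 pi i j/k), a k-th root of unity other than 1, so the geometric sum vanishes. *)
Lemma Csum_root_of_unity (n j : nat) : (j <= n)%nat ->
  Csum (fun m => (Cexp (2 * Ci * - root_arg n m) ^ j)%C) 0 n
  = if Nat.eq_dec j 0 then RtoC (INR (S n)) else 0%C.
Proof.
  intros Hj. generalize (RtoC_neq _ (not_0_INR (S n) (Nat.neq_succ_0 n))); intros Hn.
  destruct (Nat.eq_dec j 0) as [->|Hj0].
  - simpl Cpow. rewrite Csum_const. ring.
  - set (w := Cexp (2 * Ci * - root_arg n j)).
    rewrite (Csum_ext _ (fun m => w ^ m)%C).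
    2:{ intros m _. unfold w. rewrite <- !Cexp_natmul. f_equal. unfold root_arg.
        unfold Rdiv. rewrite !RtoC_mult. ring. }
    assert (Hw : w <> 1%C).
    { apply Cexp2_neq1. rewrite Csin_opp.
      assert (H : Csin (root_arg n j) <> 0%C).
      { apply Csin_neq0. left. unfold root_arg. rewrite !INR_IZR_INZ.
        apply sin_neq0_not_divide; [lia|]. intros D. apply Z.divide_pos_le in D; lia. }
      intros E. apply H. replace (Csin (root_arg n j)) with (- - Csin (root_arg n j))%C by ring.
      rewrite E. ring. }
    assert (H1 : (w ^ S n = 1)%C).
    { unfold w. rewrite <- Cexp_natmul.
      replace (INR (S n) * (2 * Ci * - root_arg n j))%C with (0, - (2 * INR j * PI)).
      - rewrite Cexp_alt. simpl Re. simpl Im. rewrite exp_0, cos_neg, sin_neg.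
        rewrite <- (Rplus_0_l (2 * INR j * PI)), cos_period, sin_period, cos_0, sin_0.
        unfold RtoC. f_equal; ring.
      - unfold root_arg. apply C_ext; simpl; field; apply not_0_INR; lia. }
    assert (Hg := Csum_geom w n). rewrite H1 in Hg.
    apply Cminus_neq0 in Hw.
    replace (Csum (fun m : nat => w ^ m)%C 0 n) with
      (/ (w - 1) * ((w - 1) * Csum (fun m : nat => w ^ m)%C 0 n))%C by (field; exact Hw).
    rewrite Hg. ring.
Qed.

(** If exp(2i(u - pi m/k)) were 1, so would be its k-th power exp(2iku). *)
Lemma Csin_root_neq0 (n m : nat) (u : C) :
  Csin (INR (S n) * u)%C <> 0%C -> Csin (u - root_arg n m)%C <> 0%C.
Proof.
  intros H. apply Cexp2_neq1 in H. apply Cexp2_neq1. intros E. apply H.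
  replace (2 * Ci * (INR (S n) * u))%C with
    (INR (S n) * (2 * Ci * (u - root_arg n m)) + (0%R, (2 * INR m * PI)%R))%C.
  - rewrite Cexp_plus, Cexp_natmul, E.
    rewrite Cexp_alt. simpl Re. simpl Im.
    rewrite <- (Rplus_0_l (2 * INR m * PI)), exp_0, cos_period, sin_period, cos_0, sin_0.
    replace (1 * 1, 1 * 0) with (RtoC 1) by (unfold RtoC; f_equal; ring).
    clear. induction (S n); simpl; [ring|]. rewrite <- Cmult_assoc, IHn0. ring.
  - unfold root_arg. destruct u as [x y]. apply C_ext; simpl; field; apply not_0_INR; lia.
Qed.

(* With [x = exp (2 i (u - pi m / k))], [cot = i + 2 i / (x - 1)] and
   [1 / (x - 1) = (1 + x + ... + x^(k-1)) / (x^k - 1)], where [x^k] does not depend on [m]. *)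
Lemma Ccot_multiplication (n : nat) (u : C) :
  Csin (INR (S n) * u)%C <> 0%C ->
  Csum (fun m => Ccot (u - root_arg n m)%C) 0 n
  = (INR (S n) * Ccot (INR (S n) * u))%C.
Proof.
  intros H. set (w := Cexp (2 * Ci * u)).
  set (x := fun m => (w * Cexp (2 * Ci * - root_arg n m))%C).
  assert (Hw : Cexp (2 * Ci * (INR (S n) * u))%C = (w ^ S n)%C).
  { unfold w. rewrite <- Cexp_natmul. f_equal. ring. }
  assert (Hw1 : (w ^ S n - 1)%C <> 0%C).
  { apply Cminus_neq0. rewrite <- Hw. now apply Cexp2_neq1. }
  assert (Hx : forall m, Cexp (2 * Ci * (u - root_arg n m))%C = x m).
  { intros m. unfold x, w. rewrite <- Cexp_plus. f_equal. ring. }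
  assert (Hxn : forall m, (x m ^ S n = w ^ S n)%C).
  { intros m. unfold x. rewrite Cpow_mult_l, <- (Cexp_natmul (S n) (2 * Ci * - _)%C).
    replace (INR (S n) * (2 * Ci * - root_arg n m))%C with (0, - (2 * INR m * PI)).
    - rewrite Cexp_alt. simpl Re. simpl Im. rewrite exp_0, cos_neg, sin_neg.
      rewrite <- (Rplus_0_l (2 * INR m * PI)), cos_period, sin_period, cos_0, sin_0.
      replace (1 * 1, 1 * - 0) with (RtoC 1) by (unfold RtoC; f_equal; ring). ring.
    - unfold root_arg. apply C_ext; simpl; field; apply not_0_INR; lia. }
  rewrite (Csum_ext _ (fun m => Ci + 2 * Ci / (w ^ S n - 1) *
    Csum (fun j => w ^ j * Cexp (2 * Ci * - root_arg n m) ^ j) 0 n)%C).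
  2:{ intros m _. rewrite Ccot_Cexp by now apply Csin_root_neq0.
      f_equal. rewrite Hx. rewrite (Csum_ext _ (fun j => x m ^ j)%C).
      2:{ intros j _. unfold x. now rewrite Cpow_mult_l. }
      assert (Hg := Csum_geom (x m) n). rewrite Hxn in Hg.
      assert (Hx1 : (x m - 1)%C <> 0%C).
      { intros E. rewrite E, Cmult_0_l in Hg. now symmetry in Hg. }
      rewrite <- Hg. field. split; [|exact Hx1].
      intros E. rewrite E, Cmult_0_r in Hg. now symmetry in Hg. }
  rewrite Csum_plus, Csum_const, Csum_mult_l.
  (* Summed over m first, every power j > 0 disappears by orthogonality. *)
  rewrite Csum_switch.
  rewrite (Csum_ext _ (fun j => w ^ j * if Nat.eq_dec j 0 then RtoC (INR (S n)) else 0)%C).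
  2:{ intros j Hj. rewrite Csum_mult_l, Csum_root_of_unity by lia. reflexivity. }
  rewrite Csum_first. rewrite Csum_zero.
  2:{ intros m Hm. destruct (Nat.eq_dec m 0); [lia|ring]. }
  rewrite Ccot_Cexp by exact H. rewrite Hw. simpl (w ^ 0)%C.
  destruct (Nat.eq_dec 0 0) as [_|]; [|lia].
  field. exact Hw1.
Qed.

Lemma Copp_mult_1 (z : C) : (- z = - 1 * z)%C.
Proof. ring. Qed.

(** The reflection of m to n + 1 - m changes the sign of each cotangent, so the sum equals its own
    opposite. *)
Lemma Csum_cot_zero (n : nat) :
  Csum (fun m => Ccot (root_arg n m)) 1 n = 0%C.
Proof.
  destruct n as [|n].
  { apply Csum_zero. intros; lia. }
  assert (E : Csum (fun m => Ccot (root_arg (S n) m)) 1 (S n)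
    = Csum (fun m => Ccot (root_arg (S n) (S m))) 0 n).
  { symmetry. exact (Csum_S (fun m => Ccot (root_arg (S n) m)) 0 n). }
  rewrite E. set (s := Csum _ _ _).
  assert (H : s = (- 1 * s)%C).
  { unfold s at 1. rewrite <- Csum_rev. unfold s. rewrite <- Csum_mult_l.
    apply Csum_ext. intros m Hm.
    assert (Hs : Csin (root_arg (S n) (S m)) <> 0%C).
    { apply Csin_neq0. left. unfold root_arg. rewrite !INR_IZR_INZ.
      apply sin_neq0_not_divide; [lia|]. intros D. apply Z.divide_pos_le in D; lia. }
    rewrite <- Copp_mult_1, <- Ccot_opp by exact Hs.
    rewrite <- (Ccot_plus_PI (- _)%C). f_equal.
    unfold root_arg. rewrite <- RtoC_opp, <- RtoC_plus. f_equal.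
    rewrite S_INR, minus_INR, (S_INR m), (S_INR (S n)), (S_INR n) by lia. field.
    generalize (pos_INR n); lra. }
  assert (H2 : (2 * s = 0)%C).
  { replace (2 * s)%C with (s + s)%C by ring. rewrite H at 1. ring. }
  replace s with (/ 2 * (2 * s))%C by field. rewrite H2. ring.
Qed.

Lemma root_arg_0 (n : nat) : root_arg n 0 = 0.
Proof. unfold root_arg. rewrite INR_0. unfold Rdiv. ring. Qed.

Lemma Csum_mult (u v : nat -> C) (a b c d : nat) :
  (Csum u a b * Csum v c d)%C = Csum (fun m => Csum (fun l => u m * v l)%C c d) a b.
Proof.
  rewrite Cmult_comm, <- Csum_mult_l. apply Csum_ext. intros m _.
  rewrite Csum_mult_l. ring.
Qed.

(** * Partial fractions of the product of two cotangents *)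

Lemma coprime_not_divide (a b m : nat) :
  Nat.gcd a b = 1%nat -> (0 < m < b)%nat ->
  ~ (Z.of_nat b | Z.of_nat m * Z.of_nat a)%Z.
Proof.
  intros Hg Hm [q Hq]. assert (D : Nat.divide b (a * m)).
  { exists (Z.to_nat q). apply Nat2Z.inj. rewrite !Nat2Z.inj_mul, Z2Nat.id.
    lia. destruct (Z_lt_le_dec q 0); [|lia]. nia. }
  apply Nat.gauss in D; [|now rewrite Nat.gcd_comm].
  apply Nat.divide_pos_le in D; lia.
Qed.

Lemma Csin_mult_root_neq0 (n h m : nat) :
  Nat.gcd h (S n) = 1%nat -> (0 < m < S n)%nat ->
  Csin (INR h * root_arg n m)%R <> 0%C.
Proof.
  intros Hg Hm. apply Csin_neq0. left.
  replace (INR h * root_arg n m) with (PI * IZR (Z.of_nat m * Z.of_nat h) / IZR (Z.of_nat (S n))).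
  - apply sin_neq0_not_divide; [lia|]. now apply coprime_not_divide.
  - unfold root_arg. rewrite mult_IZR, !INR_IZR_INZ. field. apply not_0_IZR. lia.
Qed.

(** An integral value of l/(p+1) - m/(n+1) forces n+1 to divide m and p+1 to divide l, by
    coprimality. Hence the two families of poles meet only at 0. *)
Lemma Csin_root_diff_neq0 (n p m l : nat) :
  Nat.gcd (S n) (S p) = 1%nat -> (m <= n)%nat -> (l <= p)%nat ->
  (m <> 0)%nat \/ (l <> 0)%nat ->
  Csin (root_arg p l - root_arg n m)%R <> 0%C.
Proof.
  intros Hg Hm Hl Hml. apply Csin_neq0. left.
  replace (root_arg p l - root_arg n m) with
    (PI * IZR (Z.of_nat l * Z.of_nat (S n) - Z.of_nat m * Z.of_nat (S p))
     / IZR (Z.of_nat (S n) * Z.of_nat (S p))).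
  2:{ unfold root_arg. rewrite minus_IZR, !mult_IZR, !INR_IZR_INZ. field.
      split; apply not_0_IZR; lia. }
  apply sin_neq0_not_divide; [lia|]. intros [q Hq].
  destruct Hml as [H|H].
  - apply (coprime_not_divide (S p) (S n) m); [now rewrite Nat.gcd_comm|lia|].
    exists (Z.of_nat l - q * Z.of_nat (S p))%Z. lia.
  - apply (coprime_not_divide (S n) (S p) l); [assumption|lia|].
    exists (Z.of_nat m + q * Z.of_nat (S n))%Z. lia.
Qed.

(** This is the multiplication formula at the other family of poles; it produces the coefficients of
    the partial fractions. At l = 0 the formula would be taken at a pole: there the sum is [Ccot 0],
    which is 0 by default, plus an odd sum that vanishes. *)
Lemma Csum_cot_root_diff (n p l : nat) :
  Nat.gcd (S n) (S p) = 1%nat -> (l <= p)%nat ->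
  Csum (fun m => Ccot (root_arg p l - root_arg n m)%R) 0 n
  = if Nat.eq_dec l 0 then 0%C else (INR (S n) * Ccot (INR (S n) * root_arg p l)%R)%C.
Proof.
  intros Hg Hl. destruct (Nat.eq_dec l 0) as [->|Hl0].
  - rewrite root_arg_0, Csum_first, root_arg_0.
    rewrite (Csum_ext _ (fun m => - 1 * Ccot (root_arg n m))%C).
    2:{ intros m Hm. rewrite <- Copp_mult_1, <- Ccot_opp.
        - f_equal. rewrite <- RtoC_opp. f_equal. ring.
        - replace (root_arg n m) with (root_arg n m - root_arg p 0) by (rewrite root_arg_0; ring).
          apply Csin_root_diff_neq0; try lia. now rewrite Nat.gcd_comm. }
    rewrite Csum_mult_l, Csum_cot_zero.
    unfold Ccot. replace (Csin (0 - 0)%R) with (RtoC 0).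
    + unfold Cdiv. rewrite Cinv_0. ring.
    + unfold RtoC. rewrite Csin_alt, Rminus_0_r, sin_0, sinh_0. f_equal; ring.
  - rewrite RtoC_mult, <- Ccot_multiplication.
    + apply Csum_ext. intros m _. now rewrite RtoC_minus.
    + rewrite <- RtoC_mult. apply Csin_mult_root_neq0; [assumption|lia].
Qed.

(** The two multiplication formulas are multiplied together and [Ccot_mult] separates each pair of
    distinct poles; the pair of equal poles falls under [Ccot_sqr] and leaves the double pole. For a
    fixed pole, the sum over the other family is then done by [Csum_cot_root_diff]. *)
Lemma Ccot_product (n p : nat) (u : C) :
  Nat.gcd (S n) (S p) = 1%nat ->
  Csin (INR (S n) * u)%C <> 0%C -> Csin (INR (S p) * u)%C <> 0%C ->
  (Ccot (INR (S p) * u) * Ccot (INR (S n) * u) =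
   - (1) + / INR (S n) * Csum (fun m => Ccot (INR (S p) * root_arg n m)%R * Ccot (u - root_arg n m)) 1 n
   + / INR (S p) * Csum (fun l => Ccot (INR (S n) * root_arg p l)%R * Ccot (u - root_arg p l)) 1 p
   + / (INR (S n) * INR (S p)) * / (Csin u * Csin u))%C.
Proof.
  intros Hg Hn Hp.
  assert (Hg' : Nat.gcd (S p) (S n) = 1%nat) by now rewrite Nat.gcd_comm.
  assert (Hu : Csin u <> 0%C).
  { generalize (Csin_root_neq0 n 0 u Hn). rewrite root_arg_0.
    now replace (u - 0)%C with u by ring. }
  set (A := fun m => Ccot (u - root_arg n m)%C).
  set (B := fun l => Ccot (u - root_arg p l)%C).
  set (d := fun m l => Ccot (root_arg p l - root_arg n m)%R).
  (* One formula for all pairs: at m = l = 0 the two terms in [d] cancel because A 0 = B 0, and the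
     rest is the formula for the squared cotangent. *)
  assert (E : forall m l, (m <= n)%nat -> (l <= p)%nat -> (A m * B l =
    (d m l * B l + - (1) * (d m l * A m)) + (- (1) +
     if Nat.eq_dec m 0 then if Nat.eq_dec l 0 then / (Csin u * Csin u) else 0 else 0))%C).
  { intros m l Hm Hl. unfold A, B, d.
    destruct (Nat.eq_dec m 0) as [Em|Em]; [destruct (Nat.eq_dec l 0) as [El|El]|].
    - subst. rewrite !root_arg_0. replace (u - 0)%C with u by ring.
      rewrite Ccot_sqr by exact Hu. ring.
    - rewrite (Ccot_mult (u - root_arg n m)%C).
      2,3: now apply Csin_root_neq0.
      + replace (u - root_arg n m - (u - root_arg p l))%C with (RtoC (root_arg p l - root_arg n m)%R)
          by (rewrite RtoC_minus; ring). ring.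
      + replace (u - root_arg n m - (u - root_arg p l))%C with (RtoC (root_arg p l - root_arg n m)%R)
          by (rewrite RtoC_minus; ring). apply Csin_root_diff_neq0; auto.
    - rewrite (Ccot_mult (u - root_arg n m)%C).
      2,3: now apply Csin_root_neq0.
      + replace (u - root_arg n m - (u - root_arg p l))%C with (RtoC (root_arg p l - root_arg n m)%R)
          by (rewrite RtoC_minus; ring). ring.
      + replace (u - root_arg n m - (u - root_arg p l))%C with (RtoC (root_arg p l - root_arg n m)%R)
          by (rewrite RtoC_minus; ring). apply Csin_root_diff_neq0; auto. }
  assert (Hn0 := RtoC_neq _ (not_0_INR (S n) (Nat.neq_succ_0 n))).
  assert (Hp0 := RtoC_neq _ (not_0_INR (S p) (Nat.neq_succ_0 p))).
  assert (Hprod : (INR (S n) * INR (S p) * (Ccot (INR (S p) * u) * Ccot (INR (S n) * u))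
    = Csum A 0 n * Csum B 0 p)%C).
  { unfold A, B. rewrite !Ccot_multiplication by assumption. ring. }
  rewrite Csum_mult in Hprod.
  rewrite (Csum_ext _ (fun m => (Csum (fun l => d m l * B l) 0 p
     + - (1) * (A m * Csum (fun l => d m l) 0 p)) + (INR (S p) * - (1) +
      Csum (fun l => if Nat.eq_dec m 0 then if Nat.eq_dec l 0 then / (Csin u * Csin u) else 0 else 0) 0 p))%C) in Hprod.
  2:{ intros m Hm. rewrite (Csum_ext _ _ _ _ (fun l Hl => E m l (proj2 Hm) (proj2 Hl))).
      rewrite !Csum_plus, Csum_const. rewrite !Csum_mult_l.
      rewrite (Csum_ext (fun l => d m l * A m)%C (fun l => A m * d m l)%C) by (intros; ring).
      rewrite Csum_mult_l. reflexivity. }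
  rewrite !Csum_plus, Csum_const, Csum_switch, !Csum_mult_l in Hprod.
  rewrite (Csum_ext (fun l => Csum (fun m => d m l * B l)%C 0 n)
     (fun l => if Nat.eq_dec l 0 then 0 else INR (S n) * (Ccot (INR (S n) * root_arg p l)%R * B l))%C) in Hprod.
  2:{ intros l Hl. rewrite (Csum_ext _ (fun m => B l * d m l)%C) by (intros; ring).
      rewrite Csum_mult_l. unfold d. rewrite Csum_cot_root_diff by (assumption || lia).
      destruct (Nat.eq_dec l 0); ring. }
  (* Here the differences occur in the opposite order, so the oddness of the cotangent gives a minus
     sign, which cancels the one in front of this sum. *)
  rewrite (Csum_ext (fun m => A m * Csum (fun l => d m l) 0 p)%C
     (fun m => if Nat.eq_dec m 0 then 0 else - INR (S p) * (Ccot (INR (S p) * root_arg n m)%R * A m))%C) in Hprod.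
  2:{ intros m Hm. destruct (Nat.eq_dec m 0) as [->|Em].
      - generalize (Csum_cot_zero p). intros Hz. unfold d. rewrite Csum_first.
        rewrite !root_arg_0. rewrite (Csum_ext _ (fun l => Ccot (root_arg p l))).
        2:{ intros; now rewrite Rminus_0_r. }
        rewrite Hz. unfold Ccot at 1. rewrite Rminus_0_r.
        replace (Csin 0) with (RtoC 0).
        2:{ unfold RtoC. rewrite Csin_alt, sin_0, sinh_0. f_equal; ring. }
        unfold Cdiv. rewrite Cinv_0. ring.
      - rewrite (Csum_ext _ (fun l => - 1 * Ccot (root_arg n m - root_arg p l)%R)%C).
        2:{ intros l Hl. unfold d. rewrite <- Copp_mult_1, <- Ccot_opp.
            - rewrite <- RtoC_opp. do 2 f_equal. ring.
            - apply Csin_root_diff_neq0; auto; lia. }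
        rewrite Csum_mult_l, Csum_cot_root_diff by (assumption || lia).
        destruct (Nat.eq_dec m 0); [lia|ring]. }
  rewrite (Csum_first (fun l => if Nat.eq_dec l 0 then _ else _)),
    (Csum_first (fun m => if Nat.eq_dec m 0 then _ else - _ * _)%C) in Hprod.
  simpl (if Nat.eq_dec 0 0 then _ else _) in Hprod.
  rewrite (Csum_ext (fun l => if Nat.eq_dec l 0 then _ else _)
     (fun l => INR (S n) * (Ccot (INR (S n) * root_arg p l)%R * B l))%C) in Hprod.
  2:{ intros l Hl. destruct (Nat.eq_dec l 0); [lia|reflexivity]. }
  rewrite (Csum_ext (fun m => if Nat.eq_dec m 0 then _ else _)
     (fun m => - INR (S p) * (Ccot (INR (S p) * root_arg n m)%R * A m))%C _ n) in Hprod.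
  2:{ intros m Hm. destruct (Nat.eq_dec m 0); [lia|reflexivity]. }
  rewrite !Csum_mult_l in Hprod.
  rewrite (Csum_first (fun m => Csum _ 0 p)), (Csum_first (fun l => if Nat.eq_dec 0 0 then _ else _)) in Hprod.
  rewrite (Csum_zero (fun l => if Nat.eq_dec 0 0 then _ else _)) in Hprod.
  2:{ intros l Hl. simpl. destruct (Nat.eq_dec l 0); [lia|reflexivity]. }
  rewrite (Csum_zero (fun m => Csum _ 0 p)) in Hprod.
  2:{ intros m Hm. apply Csum_zero. intros l Hl. destruct (Nat.eq_dec m 0); [lia|reflexivity]. }
  simpl (if Nat.eq_dec 0 0 then _ else _) in Hprod.
  unfold A, B in Hprod.
  apply (f_equal (fun x => / (INR (S n) * INR (S p)) * x)%C) in Hprod.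
  match type of Hprod with ?l = _ => replace l with (Ccot (INR (S p) * u) * Ccot (INR (S n) * u))%C in Hprod
    by (field; auto) end.
  rewrite Hprod. field. repeat split; assumption.
Qed.

(** * Complex derivatives and powers *)

Definition is_path_derive (g : R -> C) (t : R) (v : C) : Prop :=
  is_derive (fun s => Re (g s)) t (Re v) /\ is_derive (fun s => Im (g s)) t (Im v).

(* Complex differentiability tested along real paths: all that the contour
   argument needs, and it reduces every rule to real differentiation. *)
Definition is_cderive (f : C -> C) (z l : C) : Prop :=
  forall (g : R -> C) (t : R) (v : C),
    g t = z -> is_path_derive g t v -> is_path_derive (fun s => f (g s)) t (l * v)%C.

Lemma is_derive_eq (f : R -> R) (x l l' : R) : is_derive f x l -> l = l' -> is_derive f x l'.
Proof. now intros H <-. Qed.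

Lemma is_path_derive_eq (g : R -> C) (t : R) (v w : C) :
  is_path_derive g t v -> v = w -> is_path_derive g t w.
Proof. now intros H <-. Qed.

Lemma is_cderive_eq (f : C -> C) (z l l' : C) : is_cderive f z l -> l = l' -> is_cderive f z l'.
Proof. now intros H <-. Qed.

Lemma is_cderive_ext (f g : C -> C) (z l : C) :
  (forall w, f w = g w) -> is_cderive f z l -> is_cderive g z l.
Proof.
  intros E H p t v Hp Hv. destruct (H p t v Hp Hv) as [H1 H2].
  split; [eapply is_derive_ext; [|exact H1]|eapply is_derive_ext; [|exact H2]];
  intros s; simpl; now rewrite E.
Qed.

Lemma is_cderive_const (c z : C) : is_cderive (fun _ => c) z 0.
Proof.
  intros g t v _ _. split; apply (is_derive_eq _ _ 0);
    [exact (is_derive_const _ _) | simpl; ring | exact (is_derive_const _ _) | simpl; ring].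
Qed.

Lemma is_cderive_id (z : C) : is_cderive (fun w => w) z 1.
Proof.
  intros g t v _ H. apply (is_path_derive_eq _ _ _ _ H). ring.
Qed.

Lemma is_cderive_plus (f g : C -> C) (z l m : C) :
  is_cderive f z l -> is_cderive g z m -> is_cderive (fun w => f w + g w)%C z (l + m)%C.
Proof.
  intros Hf Hg p t v Hp Hv. destruct (Hf p t v Hp Hv) as [F1 F2], (Hg p t v Hp Hv) as [G1 G2].
  split; eapply is_derive_eq.
  - exact (is_derive_plus _ _ _ _ _ F1 G1).
  - unfold plus; simpl. ring.
  - exact (is_derive_plus _ _ _ _ _ F2 G2).
  - unfold plus; simpl. ring.
Qed.

Lemma is_derive_Rmult (f g : R -> R) (x df dg : R) :
  is_derive f x df -> is_derive g x dg ->
  is_derive (fun t => f t * g t) x (df * g x + f x * dg).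
Proof. intros Hf Hg. exact (is_derive_mult f g x df dg Hf Hg Rmult_comm). Qed.

Lemma is_cderive_mult (f g : C -> C) (z l m : C) :
  is_cderive f z l -> is_cderive g z m ->
  is_cderive (fun w => f w * g w)%C z (l * g z + f z * m)%C.
Proof.
  intros Hf Hg p t v Hp Hv. destruct (Hf p t v Hp Hv) as [F1 F2], (Hg p t v Hp Hv) as [G1 G2].
  subst z. split; eapply is_derive_eq.
  - exact (is_derive_minus _ _ _ _ _ (is_derive_Rmult _ _ _ _ _ F1 G1) (is_derive_Rmult _ _ _ _ _ F2 G2)).
  - unfold minus, plus, opp; simpl. unfold Re, Im. ring.
  - exact (is_derive_plus _ _ _ _ _ (is_derive_Rmult _ _ _ _ _ F1 G2) (is_derive_Rmult _ _ _ _ _ F2 G1)).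
  - unfold plus; simpl. unfold Re, Im. ring.
Qed.

Lemma is_cderive_comp (f g : C -> C) (z l m : C) :
  is_cderive f (g z) l -> is_cderive g z m -> is_cderive (fun w => f (g w)) z (l * m)%C.
Proof.
  intros Hf Hg p t v Hp Hv. apply (is_path_derive_eq _ _ (l * (m * v))%C); [|ring].
  apply Hf; [now rewrite Hp|]. exact (Hg p t v Hp Hv).
Qed.

Lemma is_cderive_scal (c : C) (f : C -> C) (z l : C) :
  is_cderive f z l -> is_cderive (fun w => c * f w)%C z (c * l)%C.
Proof.
  intros H. eapply is_cderive_eq.
  - exact (is_cderive_mult _ _ _ _ _ (is_cderive_const c z) H).
  - simpl; ring.
Qed.

Lemma is_cderive_Cexp (z : C) : is_cderive Cexp z (Cexp z).
Proof.
  intros p t v <- [H1 H2].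
  split.
  - apply (is_derive_ext (fun s => exp (Re (p s)) * cos (Im (p s)))).
    { intros s. now rewrite Cexp_alt. }
    eapply is_derive_eq.
    + apply is_derive_Rmult.
      * exact (is_derive_comp exp _ _ _ _ (is_derive_exp _) H1).
      * exact (is_derive_comp cos _ _ _ _ (is_derive_cos _) H2).
    + rewrite Cexp_alt. unfold scal; simpl; unfold mult; simpl. unfold Re, Im. ring.
  - apply (is_derive_ext (fun s => exp (Re (p s)) * sin (Im (p s)))).
    { intros s. now rewrite Cexp_alt. }
    eapply is_derive_eq.
    + apply is_derive_Rmult.
      * exact (is_derive_comp exp _ _ _ _ (is_derive_exp _) H1).
      * exact (is_derive_comp sin _ _ _ _ (is_derive_sin _) H2).
    + rewrite Cexp_alt. unfold scal; simpl; unfold mult; simpl. unfold Re, Im. ring.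
Qed.

Lemma Cnorm2_pos (z : C) : z <> 0%C -> 0 < Re z ^ 2 + Im z ^ 2.
Proof.
  intros H. rewrite <- Cmod2_alt. generalize (Cmod_gt_0 z). intros [H' _]. specialize (H' H). nra.
Qed.

(** For a path u + iv this concerns the real part of its inverse; exchanging u and v gives the
    imaginary part up to sign. *)
Lemma is_derive_div_norm2 (u v : R -> R) (t du dv : R) :
  is_derive u t du -> is_derive v t dv -> 0 < u t ^ 2 + v t ^ 2 ->
  is_derive (fun s => u s / (u s ^ 2 + v s ^ 2)) t
    ((du * (v t ^ 2 - u t ^ 2) - 2 * u t * v t * dv) / (u t ^ 2 + v t ^ 2) ^ 2).
Proof.
  intros H1 H2 Hn.
  assert (E1 : ex_derive u t) by (eexists; exact H1).
  assert (E2 : ex_derive v t) by (eexists; exact H2).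
  auto_derive; [repeat split; auto; lra|].
  replace (Derive (fun x : R => u x) t) with du by (symmetry; exact (is_derive_unique u t du H1));
  replace (Derive (fun x : R => v x) t) with dv by (symmetry; exact (is_derive_unique v t dv H2)).
  try replace (INR 2) with 2 by (rewrite S_INR, INR_1; ring). field. lra.
Qed.

Lemma is_cderive_Cinv (z : C) : z <> 0%C -> is_cderive Cinv z (- (/ z * / z))%C.
Proof.
  intros Hz p t v Hp [H1 H2]. generalize (Cnorm2_pos z Hz). rewrite <- Hp. intros Hn.
  split; unfold Cinv; simpl Re; simpl Im.
  - eapply is_derive_eq; [exact (is_derive_div_norm2 _ _ _ _ _ H1 H2 Hn)|].
    cbv beta; destruct (p t) as [x y], v as [a b]. simpl in *. field. lra.
  - apply (is_derive_ext (fun s => - (Im (p s) / (Im (p s) ^ 2 + Re (p s) ^ 2)))).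
    { intros s. match goal with |- ?a = ?b => change (a = b :> R) end. unfold Rdiv, Re, Im; simpl. rewrite (Rplus_comm (snd (p s) * (snd (p s) * 1))). ring. }
    rewrite Rplus_comm in Hn.
    eapply is_derive_eq; [exact (is_derive_opp _ _ _ (is_derive_div_norm2 _ _ _ _ _ H2 H1 Hn))|].
    cbv beta; destruct (p t) as [x y], v as [a b]. unfold opp; simpl in *. field. lra.
Qed.

Lemma Re_pos_neq0 (z : C) : 0 < Re z -> z <> 0%C.
Proof. intros H E. rewrite E in H. simpl in H. lra. Qed.

Lemma Carg_pos (z : C) : 0 < Re z -> Carg z = atan (Im z / Re z).
Proof. intros H. unfold Carg. now destruct (Rlt_dec 0 (Re z)). Qed.

Lemma is_derive_ln_norm (u v : R -> R) (t du dv : R) :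
  is_derive u t du -> is_derive v t dv -> 0 < u t ^ 2 + v t ^ 2 ->
  is_derive (fun s => ln (sqrt (u s ^ 2 + v s ^ 2))) t
    ((du * u t + dv * v t) / (u t ^ 2 + v t ^ 2)).
Proof.
  intros H1 H2 Hn.
  assert (E1 : ex_derive u t) by (eexists; exact H1).
  assert (E2 : ex_derive v t) by (eexists; exact H2).
  assert (HS : 0 < sqrt (u t ^ 2 + v t ^ 2)) by now apply sqrt_lt_R0.
  auto_derive; [repeat split; simpl in *; auto; lra|].
  replace (Derive (fun x : R => u x) t) with du by (symmetry; exact (is_derive_unique u t du H1));
  replace (Derive (fun x : R => v x) t) with dv by (symmetry; exact (is_derive_unique v t dv H2)).
  try replace (INR 2) with 2 by (rewrite S_INR, INR_1; ring).
  assert (Hs := sqrt_sqrt (u t ^ 2 + v t ^ 2) (Rlt_le _ _ Hn)). simpl in *.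
  set (S := sqrt _) in *.
  apply (Rmult_eq_reg_r (S * S)); [|nra].
  transitivity (du * u t + dv * v t); [field; lra|]. rewrite Hs. field. lra.
Qed.

Lemma is_derive_atan_div (u v : R -> R) (t du dv : R) :
  is_derive u t du -> is_derive v t dv -> 0 < u t ->
  is_derive (fun s => atan (v s / u s)) t
    ((dv * u t - du * v t) / (u t ^ 2 + v t ^ 2)).
Proof.
  intros H1 H2 Hn.
  assert (E1 : ex_derive u t) by (eexists; exact H1).
  assert (E2 : ex_derive v t) by (eexists; exact H2).
  auto_derive; [repeat split; auto; lra|].
  replace (Derive (fun x : R => u x) t) with du by (symmetry; exact (is_derive_unique u t du H1));
  replace (Derive (fun x : R => v x) t) with dv by (symmetry; exact (is_derive_unique v t dv H2)).
  try replace (INR 2) with 2 by (rewrite S_INR, INR_1; ring). field.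
  split; [|lra]. nra.
Qed.

Lemma is_cderive_Clog (z : C) : 0 < Re z -> is_cderive Clog z (/ z)%C.
Proof.
  intros Hz p t v Hp [H1 H2]. rewrite <- Hp in Hz.
  generalize (Cnorm2_pos _ (Re_pos_neq0 _ Hz)). rewrite <- Hp. intros Hn.
  (* Near t the path stays in the right half-plane, where [Carg] is a single arctangent. *)
  assert (L : locally t (fun s => 0 < Re (p s))).
  { apply (ex_derive_continuous (fun s => Re (p s)) t (ex_intro _ _ H1) (fun x => 0 < x)).
    exact (open_gt 0 (Re (p t)) Hz). }
  split.
  - eapply is_derive_eq; [exact (is_derive_ln_norm _ _ _ _ _ H1 H2 Hn)|].
    cbv beta; destruct (p t) as [x y], v as [a b]. simpl in *. field. lra.
  - apply (is_derive_ext_loc (fun s => atan (Im (p s) / Re (p s)))).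
    + revert L. apply filter_imp. intros s Hs. simpl. symmetry. now apply Carg_pos.
    + eapply is_derive_eq; [exact (is_derive_atan_div _ _ _ _ _ H1 H2 Hz)|].
      cbv beta; destruct (p t) as [x y], v as [a b]. simpl in *. field. lra.
Qed.

Lemma Cexp_Clog (z : C) : 0 < Re z -> Cexp (Clog z) = z.
Proof.
  intros H. rewrite Cexp_alt. unfold Clog; simpl Re; simpl Im. rewrite Carg_pos by exact H.
  assert (Hm : 0 < Cmod z) by (apply Cmod_gt_0, Re_pos_neq0, H).
  rewrite exp_ln by exact Hm. rewrite cos_atan, sin_atan.
  assert (E : sqrt (1 + (Im z / Re z) ^ 2) = Cmod z / Re z).
  { apply sqrt_lem_1.
    - generalize (pow2_ge_0 (Im z / Re z)); lra.
    - apply Rlt_le, Rdiv_lt_0_compat; assumption.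
    - generalize (Cmod2_alt z). intros E. replace (Cmod z / Re z * (Cmod z / Re z)) with
        (Cmod z ^ 2 / Re z ^ 2) by (field; lra). rewrite E. field. lra. }
  unfold Rsqr. replace (Im z / Re z * (Im z / Re z)) with ((Im z / Re z) ^ 2) by ring.
  rewrite E. apply C_ext; simpl; field; lra.
Qed.

Lemma Cpower_plus (z s t : C) : Cpower z (s + t)%C = (Cpower z s * Cpower z t)%C.
Proof. unfold Cpower. rewrite <- Cexp_plus. f_equal. ring. Qed.

Lemma Cpower_neq0 (z s : C) : Cpower z s <> 0%C.
Proof. apply Cexp_neq0. Qed.

Lemma Cpower_opp (z s : C) : Cpower z (- s)%C = (/ Cpower z s)%C.
Proof. unfold Cpower. rewrite <- Cexp_opp. f_equal. ring. Qed.

Lemma Cpower_1 (z : C) : 0 < Re z -> Cpower z 1 = z.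
Proof. intros H. unfold Cpower. rewrite Cmult_1_l. now apply Cexp_Clog. Qed.

Lemma is_cderive_Cpower (s z : C) : 0 < Re z ->
  is_cderive (fun w => Cpower w s) z (s * Cpower z (s - 1))%C.
Proof.
  intros H. unfold Cpower. eapply is_cderive_eq.
  - apply (is_cderive_comp Cexp (fun w => s * Clog w)%C).
    + apply is_cderive_Cexp.
    + apply is_cderive_scal, is_cderive_Clog, H.
  - fold (Cpower z s). fold (Cpower z (s - 1)%C). unfold Cminus.
    rewrite Cpower_plus, Cpower_opp, Cpower_1 by exact H. ring.
Qed.

Lemma Clog_pos (x : R) : 0 < x -> Clog x = RtoC (ln x).
Proof.
  intros H. unfold Clog. rewrite Carg_pos by exact H. simpl.
  unfold Rdiv. rewrite Rmult_0_l, atan_0, Cmod_R, Rabs_pos_eq by lra. reflexivity.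
Qed.

Lemma Cpower_Rmult (x y : R) (s : C) : 0 < x -> 0 < y ->
  Cpower (x * y)%R s = (Cpower x s * Cpower y s)%C.
Proof.
  intros Hx Hy. unfold Cpower. rewrite !Clog_pos by (try apply Rmult_lt_0_compat; assumption).
  rewrite ln_mult, RtoC_plus, <- Cexp_plus by assumption. f_equal. ring.
Qed.

Lemma Cmod_Cpower (z s : C) :
  z <> 0%C -> Cmod (Cpower z s) = Rpower (Cmod z) (Re s) * exp (- (Im s * Carg z)).
Proof.
  intros H. unfold Cpower, Rpower. rewrite Cmod_Cexp, <- exp_plus. f_equal.
Qed.

(** A nonreal exponent contributes the factor exp(- Im s arg z), which stays bounded because |arg z|
    < pi/2 in the right half-plane. *)
Lemma Cmod_Cpower_le (z s : C) :
  0 < Re z -> Cmod (Cpower z s) <= Rpower (Cmod z) (Re s) * exp (Rabs (Im s) * PI).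
Proof.
  intros H. rewrite Cmod_Cpower by now apply Re_pos_neq0.
  apply Rmult_le_compat_l; [left; apply exp_pos|].
  rewrite Carg_pos by exact H. generalize (atan_bound (Im z / Re z)), PI_RGT_0.
  set (w := atan _). intros Hw HP.
  assert (Hle : - (Im s * w) <= Rabs (Im s) * PI).
  { apply (Rle_trans _ (Rabs (- (Im s * w)))); [apply Rle_abs|].
    rewrite Rabs_Ropp, Rabs_mult. apply Rmult_le_compat_l; [apply Rabs_pos|].
    apply Rabs_le. lra. }
  destruct Hle as [Hlt|Heq]; [left; now apply exp_increasing|right; now rewrite Heq].
Qed.

(** * Continuity and integrals along vertical lines *)

(** Joint continuity in the two real coordinates is the form required for differentiating an
    integral with respect to a parameter. *)
Definition ccontinuous (f : C -> C) (z : C) : Prop :=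
  continuity_2d_pt (fun x y => Re (f (x, y))) (Re z) (Im z) /\
  continuity_2d_pt (fun x y => Im (f (x, y))) (Re z) (Im z).

Lemma ccontinuous_const (c z : C) : ccontinuous (fun _ => c) z.
Proof. split; apply continuity_2d_pt_const. Qed.

Lemma ccontinuous_id (z : C) : ccontinuous (fun w => w) z.
Proof. split; [apply continuity_2d_pt_id1 | apply continuity_2d_pt_id2]. Qed.

Lemma ccontinuous_ext (f g : C -> C) (z : C) :
  (forall w, f w = g w) -> ccontinuous f z -> ccontinuous g z.
Proof.
  intros E [H1 H2]. split; [eapply continuity_2d_pt_ext; [|exact H1] | eapply continuity_2d_pt_ext; [|exact H2]];
  intros x y; simpl; now rewrite E.
Qed.

Lemma ccontinuous_plus (f g : C -> C) (z : C) :
  ccontinuous f z -> ccontinuous g z -> ccontinuous (fun w => f w + g w)%C z.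
Proof.
  intros [F1 F2] [G1 G2]. split.
  - exact (continuity_2d_pt_plus _ _ _ _ F1 G1).
  - exact (continuity_2d_pt_plus _ _ _ _ F2 G2).
Qed.

Lemma ccontinuous_mult (f g : C -> C) (z : C) :
  ccontinuous f z -> ccontinuous g z -> ccontinuous (fun w => f w * g w)%C z.
Proof.
  intros [F1 F2] [G1 G2]. split.
  - exact (continuity_2d_pt_minus _ _ _ _ (continuity_2d_pt_mult _ _ _ _ F1 G1) (continuity_2d_pt_mult _ _ _ _ F2 G2)).
  - exact (continuity_2d_pt_plus _ _ _ _ (continuity_2d_pt_mult _ _ _ _ F1 G2) (continuity_2d_pt_mult _ _ _ _ F2 G1)).
Qed.

Lemma ccontinuous_opp (f : C -> C) (z : C) : ccontinuous f z -> ccontinuous (fun w => - f w)%C z.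
Proof.
  intros H. apply (ccontinuous_ext (fun w => - (1) * f w)%C); [intros; ring|].
  apply ccontinuous_mult; [apply ccontinuous_const|exact H].
Qed.

Lemma ccontinuous_minus (f g : C -> C) (z : C) :
  ccontinuous f z -> ccontinuous g z -> ccontinuous (fun w => f w - g w)%C z.
Proof. intros Hf Hg. apply ccontinuous_plus; [exact Hf | now apply ccontinuous_opp]. Qed.

Lemma continuity_1d_2d (f : R -> R) (g : R -> R -> R) (x y : R) :
  continuous f (g x y) -> continuity_2d_pt g x y -> continuity_2d_pt (fun u v => f (g u v)) x y.
Proof.
  intros H. apply continuity_1d_2d_pt_comp. now apply continuity_pt_filterlim.
Qed.

Lemma ccontinuous_Cexp (f : C -> C) (z : C) : ccontinuous f z -> ccontinuous (fun w => Cexp (f w)) z.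
Proof.
  intros [F1 F2]. split.
  - apply (continuity_2d_pt_ext (fun x y => exp (Re (f (x, y))) * cos (Im (f (x, y))))).
    { intros x y. now rewrite Cexp_alt. }
    apply continuity_2d_pt_mult.
    + apply (continuity_1d_2d exp); [apply continuous_exp|exact F1].
    + apply (continuity_1d_2d cos); [apply continuous_cos|exact F2].
  - apply (continuity_2d_pt_ext (fun x y => exp (Re (f (x, y))) * sin (Im (f (x, y))))).
    { intros x y. now rewrite Cexp_alt. }
    apply continuity_2d_pt_mult.
    + apply (continuity_1d_2d exp); [apply continuous_exp|exact F1].
    + apply (continuity_1d_2d sin); [apply continuous_sin|exact F2].
Qed.

Lemma continuity_2d_pt_norm2 (f g : R -> R -> R) (x y : R) :
  continuity_2d_pt f x y -> continuity_2d_pt g x y ->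
  continuity_2d_pt (fun u v => f u v ^ 2 + g u v ^ 2) x y.
Proof.
  intros F G. apply (continuity_2d_pt_ext (fun u v => f u v * f u v + g u v * g u v)).
  { intros; ring. }
  apply continuity_2d_pt_plus; now apply continuity_2d_pt_mult.
Qed.

Lemma ccontinuous_Cinv (f : C -> C) (z : C) :
  f z <> 0%C -> ccontinuous f z -> ccontinuous (fun w => / f w)%C z.
Proof.
  intros Hz [F1 F2]. generalize (Cnorm2_pos _ Hz). intros Hn.
  assert (Hi : continuity_2d_pt (fun x y => / (Re (f (x, y)) ^ 2 + Im (f (x, y)) ^ 2)) (Re z) (Im z)).
  { apply continuity_2d_pt_inv; [now apply continuity_2d_pt_norm2|].
    replace (Re z, Im z) with z by now destruct z. lra. }
  split; unfold Cinv, Rdiv; simpl.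
  - exact (continuity_2d_pt_mult _ _ _ _ F1 Hi).
  - exact (continuity_2d_pt_mult _ _ _ _ (continuity_2d_pt_opp _ _ _ F2) Hi).
Qed.

Lemma ccontinuous_Clog (f : C -> C) (z : C) :
  0 < Re (f z) -> ccontinuous f z -> ccontinuous (fun w => Clog (f w)) z.
Proof.
  intros Hz [F1 F2]. generalize (Cnorm2_pos _ (Re_pos_neq0 _ Hz)). intros Hn.
  assert (Ez : (Re z, Im z) = z) by now destruct z.
  split.
  - unfold Clog, Cmod; simpl.
    apply (continuity_1d_2d ln).
    { apply continuous_ln, sqrt_lt_R0. rewrite Ez. exact Hn. }
    apply (continuity_1d_2d sqrt); [apply continuous_sqrt|].
    now apply continuity_2d_pt_norm2.
  - apply (continuity_2d_pt_ext_loc (fun x y => atan (Im (f (x, y)) * / Re (f (x, y))))).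
    + specialize (F1 (mkposreal _ Hz)). revert F1. apply locally_2d_impl, locally_2d_forall.
      intros u v. simpl. rewrite Ez. intros H. apply Rabs_lt_between' in H.
      symmetry. apply Carg_pos. lra.
    + apply (continuity_1d_2d atan); [apply continuous_atan|].
      apply continuity_2d_pt_mult; [exact F2|].
      apply continuity_2d_pt_inv; [exact F1|]. rewrite Ez. lra.
Qed.

Lemma ccontinuous_Cpower (s z : C) : 0 < Re z -> ccontinuous (fun w => Cpower w s) z.
Proof.
  intros H. apply ccontinuous_Cexp, ccontinuous_mult; [apply ccontinuous_const|].
  apply ccontinuous_Clog; [exact H|apply ccontinuous_id].
Qed.

Lemma continuity_2d_slice (f : R -> R -> R) (x y : R) :
  continuity_2d_pt f x y -> continuous (f x) y.
Proof.
  intros H. apply filterlim_locally. intros eps.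
  destruct (H eps) as [d Hd]. exists d. intros t Ht. apply Hd; [|exact Ht].
  rewrite Rminus_diag, Rabs_R0. apply cond_pos.
Qed.

Lemma is_cderive_horizontal (f : C -> C) (x y : R) (l : C) :
  is_cderive f (x, y) l ->
  is_derive (fun u => Re (f (u, y))) x (Re l) /\ is_derive (fun u => Im (f (u, y))) x (Im l).
Proof.
  intros H. destruct (H (fun u => (u, y)) x 1%C eq_refl) as [H1 H2].
  - split; simpl; [exact (is_derive_id (K := R_AbsRing) x)|exact (is_derive_const y x)].
  - rewrite Cmult_1_r in H1, H2. now split.
Qed.

Lemma is_cderive_vertical (f : C -> C) (x y : R) (l : C) :
  is_cderive f (x, y) l ->
  is_derive (fun v => Re (f (x, v))) y (- Im l) /\ is_derive (fun v => Im (f (x, v))) y (Re l).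
Proof.
  intros H. destruct (H (fun v => (x, v)) y Ci eq_refl) as [H1 H2].
  - split; simpl; [exact (is_derive_const x y)|exact (is_derive_id (K := R_AbsRing) y)].
  - split; eapply is_derive_eq.
    + exact H1.
    + unfold Re, Im; simpl. ring.
    + exact H2.
    + unfold Re, Im; simpl. ring.
Qed.

(** Taken by components, so that the calculus of real integrals applies directly; [is_RInt_Cint]
    relates it to the integral of C-valued functions behind [vline_int]. The integration is in y,
    without the factor i of dz. *)
Definition Cint (g : R -> C) (a b : R) : C :=
  (RInt (fun y => Re (g y)) a b, RInt (fun y => Im (g y)) a b).

Definition ex_Cint (g : R -> C) (a b : R) : Prop :=
  ex_RInt (fun y => Re (g y)) a b /\ ex_RInt (fun y => Im (g y)) a b.

Definition continuous_C (g : R -> C) (y : R) : Prop :=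
  continuous (fun t => Re (g t)) y /\ continuous (fun t => Im (g t)) y.

Lemma ccontinuous_vertical (f : C -> C) (x y : R) :
  ccontinuous f (x, y) -> continuous_C (fun v => f (x, v)) y.
Proof. intros [H1 H2]. split; [exact (continuity_2d_slice _ _ _ H1)|exact (continuity_2d_slice _ _ _ H2)]. Qed.

Lemma ex_Cint_continuous (g : R -> C) (a b : R) :
  (forall y, Rmin a b <= y <= Rmax a b -> continuous_C g y) -> ex_Cint g a b.
Proof. intros H. split; apply (ex_RInt_continuous (V := R_CompleteNormedModule)); intros y Hy; apply (H y Hy). Qed.

Lemma is_RInt_RInt (f : R -> R) (a b : R) : ex_RInt f a b -> is_RInt f a b (RInt f a b).
Proof. exact (RInt_correct (V := R_CompleteNormedModule) f a b). Qed.

Lemma is_RInt_Cint (g : R -> C) (a b : R) :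
  ex_Cint g a b -> is_RInt (V := C_R_NormedModule) g a b (Cint g a b).
Proof.
  intros [H1 H2].
  exact (is_RInt_fct_extend_pair (U := R_NormedModule) (V := R_NormedModule) g a b _ _
    (is_RInt_RInt _ _ _ H1) (is_RInt_RInt _ _ _ H2)).
Qed.

Lemma Cint_ext (f g : R -> C) (a b : R) :
  (forall y, f y = g y) -> Cint f a b = Cint g a b.
Proof. intros H. unfold Cint. f_equal; apply RInt_ext; intros; now rewrite H. Qed.

Lemma Cint_plus (f g : R -> C) (a b : R) : ex_Cint f a b -> ex_Cint g a b ->
  Cint (fun y => f y + g y)%C a b = (Cint f a b + Cint g a b)%C.
Proof.
  intros [F1 F2] [G1 G2]. apply C_ext.
  - exact (RInt_plus _ _ a b F1 G1).
  - exact (RInt_plus _ _ a b F2 G2).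
Qed.

Lemma ex_Cint_plus (f g : R -> C) (a b : R) : ex_Cint f a b -> ex_Cint g a b ->
  ex_Cint (fun y => f y + g y)%C a b.
Proof.
  intros [F1 F2] [G1 G2]. split.
  - exact (ex_RInt_plus _ _ a b F1 G1).
  - exact (ex_RInt_plus _ _ a b F2 G2).
Qed.

Lemma is_RInt_Cscal (c : C) (f : R -> C) (a b : R) : ex_Cint f a b ->
  is_RInt (fun y => Re (c * f y)%C) a b (Re (c * Cint f a b)%C) /\
  is_RInt (fun y => Im (c * f y)%C) a b (Im (c * Cint f a b)%C).
Proof.
  intros [F1 F2]. apply is_RInt_RInt in F1. apply is_RInt_RInt in F2. split.
  - exact (is_RInt_minus _ _ a b _ _ (is_RInt_scal _ _ _ (Re c) _ F1) (is_RInt_scal _ _ _ (Im c) _ F2)).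
  - exact (is_RInt_plus _ _ a b _ _ (is_RInt_scal _ _ _ (Re c) _ F2) (is_RInt_scal _ _ _ (Im c) _ F1)).
Qed.

Lemma Cint_scal (c : C) (f : R -> C) (a b : R) : ex_Cint f a b ->
  Cint (fun y => c * f y)%C a b = (c * Cint f a b)%C.
Proof.
  intros H. destruct (is_RInt_Cscal c f a b H) as [H1 H2].
  apply C_ext; simpl Re; simpl Im; now apply is_RInt_unique.
Qed.

Lemma ex_Cint_scal (c : C) (f : R -> C) (a b : R) : ex_Cint f a b -> ex_Cint (fun y => c * f y)%C a b.
Proof. intros H. destruct (is_RInt_Cscal c f a b H) as [H1 H2]. split; eexists; eassumption. Qed.

Lemma Cint_Chasles (g : R -> C) (a b c : R) : ex_Cint g a b -> ex_Cint g b c ->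
  (Cint g a b + Cint g b c)%C = Cint g a c.
Proof.
  intros [F1 F2] [G1 G2]. apply C_ext.
  - exact (RInt_Chasles _ a b c F1 G1).
  - exact (RInt_Chasles _ a b c F2 G2).
Qed.

Lemma Rabs_Im_le_Cmod (z : C) : Rabs (Im z) <= Cmod z.
Proof. generalize (Rmax_Cmod z). intros H. eapply Rle_trans; [apply Rmax_r|exact H]. Qed.

Lemma Rabs_Re_le_Cmod (z : C) : Rabs (Re z) <= Cmod z.
Proof. generalize (Rmax_Cmod z). intros H. eapply Rle_trans; [apply Rmax_l|exact H]. Qed.

Lemma Cmod_le_Rabs (z : C) : Cmod z <= Rabs (Re z) + Rabs (Im z).
Proof.
  destruct z as [x y]. simpl. replace (x, y) with (RtoC x + Ci * y)%C.
  - eapply Rle_trans; [apply Cmod_triangle|]. rewrite Cmod_mult, !Cmod_R, Cmod_Ci. lra.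
  - apply C_ext; simpl; ring.
Qed.

(** The factor 2 comes from bounding real and imaginary parts separately; it recurs in all later
    estimates. *)
Lemma Cmod_Cint_le (g : R -> C) (r : R -> R) (a b : R) :
  a <= b -> ex_Cint g a b -> ex_RInt r a b ->
  (forall y, a <= y <= b -> Cmod (g y) <= r y) ->
  Cmod (Cint g a b) <= 2 * RInt r a b.
Proof.
  intros Hab [H1 H2] Hr Hle.
  assert (A1 : Rabs (RInt (fun y => Re (g y)) a b) <= RInt r a b).
  { apply (norm_RInt_le (V := R_NormedModule) (fun y => Re (g y)) r a b); auto using is_RInt_RInt.
    intros y Hy. eapply Rle_trans; [apply Rabs_Re_le_Cmod|]. auto. }
  assert (A2 : Rabs (RInt (fun y => Im (g y)) a b) <= RInt r a b).
  { apply (norm_RInt_le (V := R_NormedModule) (fun y => Im (g y)) r a b); auto using is_RInt_RInt.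
    intros y Hy. eapply Rle_trans; [apply Rabs_Im_le_Cmod|]. auto. }
  eapply Rle_trans; [apply Cmod_le_Rabs|]. simpl. lra.
Qed.

Lemma Cmod_Cint_le_const (g : R -> C) (M a b : R) :
  a <= b -> ex_Cint g a b -> (forall y, a <= y <= b -> Cmod (g y) <= M) ->
  Cmod (Cint g a b) <= 2 * ((b - a) * M).
Proof.
  intros Hab Hg HM. replace ((b - a) * M) with (RInt (fun _ => M) a b).
  - apply Cmod_Cint_le; auto. apply ex_RInt_const.
  - rewrite RInt_const. reflexivity.
Qed.

Lemma Cint_derive (f df : C -> C) (x a b : R) :
  (forall y, Rmin a b <= y <= Rmax a b ->
    is_cderive f (x, y) (df (x, y)) /\ ccontinuous df (x, y)) ->
  Cint (fun y => Ci * df (x, y))%C a b = (f (x, b) - f (x, a))%C.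
Proof.
  intros H.
  assert (Hc : forall y, Rmin a b <= y <= Rmax a b -> continuous_C (fun v => Ci * df (x, v))%C y).
  { intros y Hy. apply (ccontinuous_vertical (fun w => Ci * df w)%C).
    apply ccontinuous_mult; [apply ccontinuous_const|apply (H y Hy)]. }
  apply C_ext; apply is_RInt_unique.
  - apply (is_RInt_derive (V := R_CompleteNormedModule) (fun y => Re (f (x, y)))).
    + intros y Hy. destruct (is_cderive_vertical f x y _ (proj1 (H y Hy))) as [D _].
      eapply is_derive_eq; [exact D|]. unfold Re, Im; simpl. ring.
    + intros y Hy. apply (Hc y Hy).
  - apply (is_RInt_derive (V := R_CompleteNormedModule) (fun y => Im (f (x, y)))).
    + intros y Hy. destruct (is_cderive_vertical f x y _ (proj1 (H y Hy))) as [_ D].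
      eapply is_derive_eq; [exact D|]. unfold Re, Im; simpl. ring.
    + intros y Hy. apply (Hc y Hy).
Qed.

(** * Moving a vertical segment *)

(** Under the integral sign the derivative of [g] in the abscissa is [d], and [w] is a primitive of
    [d] in the vertical direction. By the Cauchy-Riemann equations, g = Re f has w = Im f, and g =
    Im f has w = - Re f. *)
Lemma is_derive_RInt_vertical (g d w : R -> R -> R) (x a b delta : R) :
  a <= b -> 0 < delta ->
  (forall u v, Rabs (u - x) < delta -> a - delta < v < b + delta ->
    is_derive (fun t => g t v) u (d u v) /\ is_derive (w u) v (d u v) /\
    continuity_2d_pt d u v /\ continuous (g u) v) ->
  is_derive (fun u => RInt (g u) a b) x (w x b - w x a).
Proof.
  intros Hab Hd H.
  assert (Hx : Rabs (x - x) < delta) by (rewrite Rminus_diag, Rabs_R0; exact Hd).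
  assert (HI : Rmin a b = a /\ Rmax a b = b) by (rewrite Rmin_left, Rmax_right; lra).
  destruct HI as [HI1 HI2].
  eapply is_derive_eq.
  - apply (is_derive_RInt_param g a b x); rewrite ?HI1, ?HI2.
    + exists (mkposreal _ Hd). intros u Hu t Ht. exists (d u t). apply H; [exact Hu|lra].
    + intros t Ht. apply (continuity_2d_pt_ext_loc d).
      * exists (mkposreal _ Hd). intros u v Hu Hv. simpl in Hu, Hv.
        symmetry. apply is_derive_unique, H; [exact Hu|].
        apply Rabs_lt_between' in Hv. lra.
      * apply H; [exact Hx|lra].
    + exists (mkposreal _ Hd). intros u Hu.
      apply (ex_RInt_continuous (V := R_CompleteNormedModule)). rewrite HI1, HI2.
      intros v Hv. apply H; [exact Hu|lra].
  - rewrite (RInt_ext _ (d x)).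
    + apply is_RInt_unique. apply (is_RInt_derive (V := R_CompleteNormedModule) (w x) (d x)); rewrite HI1, HI2.
      * intros v Hv. apply H; [exact Hx|lra].
      * intros v Hv. apply continuity_2d_slice. apply H; [exact Hx|lra].
    + rewrite HI1, HI2. intros v Hv. apply is_derive_unique, H; [exact Hx|lra].
Qed.

Definition is_C1 (f df : C -> C) (z : C) : Prop :=
  is_cderive f z (df z) /\ ccontinuous df z.

Lemma is_C1_vertical (f df : C -> C) (x y : R) :
  is_C1 f df (x, y) -> continuous_C (fun v => f (x, v)) y.
Proof.
  intros [H _]. destruct (is_cderive_vertical _ _ _ _ H) as [H1 H2].
  split; apply (ex_derive_continuous (K := R_AbsRing) (V := R_NormedModule)); eexists; eassumption.
Qed.

Lemma ex_Cint_C1 (f df : C -> C) (x a b : R) : a <= b ->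
  (forall y, a <= y <= b -> is_C1 f df (x, y)) -> ex_Cint (fun y => f (x, y)) a b.
Proof.
  intros Hab H. apply ex_Cint_continuous. rewrite Rmin_left, Rmax_right by exact Hab.
  intros y Hy. apply (is_C1_vertical f df), H, Hy.
Qed.

Lemma is_derive_Cint_vertical (f df : C -> C) (x a b delta : R) :
  a <= b -> 0 < delta ->
  (forall u v, Rabs (u - x) < delta -> a - delta < v < b + delta -> is_C1 f df (u, v)) ->
  is_derive (fun u => Re (Cint (fun y => f (u, y)) a b)) x
    (Re (- Ci * (f (x, b) - f (x, a)))%C) /\
  is_derive (fun u => Im (Cint (fun y => f (u, y)) a b)) x
    (Im (- Ci * (f (x, b) - f (x, a)))%C).
Proof.
  intros Hab Hd H. split.
  - eapply is_derive_eq.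
    + apply (is_derive_RInt_vertical (fun u v => Re (f (u, v))) (fun u v => Re (df (u, v)))
        (fun u v => Im (f (u, v))) x a b delta Hab Hd).
      intros u v Hu Hv. specialize (H u v Hu Hv).
      destruct (is_cderive_horizontal _ _ _ _ (proj1 H)), (is_cderive_vertical _ _ _ _ (proj1 H)).
      split; [assumption|split; [assumption|split]].
      * apply H.
      * apply (is_C1_vertical _ _ _ _ H).
    + unfold Re, Im; simpl. ring.
  - eapply is_derive_eq.
    + apply (is_derive_RInt_vertical (fun u v => Im (f (u, v))) (fun u v => Im (df (u, v)))
        (fun u v => - Re (f (u, v))) x a b delta Hab Hd).
      intros u v Hu Hv. specialize (H u v Hu Hv).
      destruct (is_cderive_horizontal _ _ _ _ (proj1 H)) as [H1 H2], (is_cderive_vertical _ _ _ _ (proj1 H)) as [H3 H4].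
      split; [assumption|split; [|split]].
      * eapply is_derive_eq; [exact (is_derive_opp _ _ _ H3)|]. unfold opp; simpl. ring.
      * apply H.
      * apply (is_C1_vertical _ _ _ _ H).
    + unfold Re, Im; simpl. ring.
Qed.

Lemma MVT_le (g dg : R -> R) (k e c0 c1 : R) :
  c0 <= c1 -> (forall c, c0 <= c <= c1 -> is_derive g c (dg c)) ->
  (forall c, c0 <= c <= c1 -> Rabs (dg c - k) <= e) ->
  Rabs (g c1 - g c0 - k * (c1 - c0)) <= e * (c1 - c0).
Proof.
  intros Hc Hg He.
  destruct (MVT_gen g c0 c1 dg) as [c [Hc' E]]; rewrite ?Rmin_left, ?Rmax_right by exact Hc.
  - intros x Hx. apply Hg. lra.
  - intros x Hx. apply continuity_pt_filterlim.
    apply (ex_derive_continuous (K := R_AbsRing) (V := R_NormedModule)). eexists. apply Hg. exact Hx.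
  - rewrite Rmin_left, Rmax_right in Hc' by exact Hc.
    rewrite E. replace (dg c * (c1 - c0) - k * (c1 - c0)) with ((dg c - k) * (c1 - c0)) by ring.
    rewrite Rabs_mult, (Rabs_pos_eq (c1 - c0)) by lra.
    apply Rmult_le_compat_r; [lra|]. now apply He.
Qed.

(* Cauchy's theorem for the rectangle [c0,c1] x [a,b], in the form of an estimate:
   only the horizontal sides contribute to the difference of the vertical ones. *)
Lemma Cint_strip (f df : C -> C) (kappa : C) (e c0 c1 a b delta : R) :
  c0 <= c1 -> a <= b -> 0 < delta ->
  (forall u v, c0 - delta < u < c1 + delta -> a - delta < v < b + delta -> is_C1 f df (u, v)) ->
  (forall u, c0 <= u <= c1 -> Cmod (- Ci * (f (u, b) - f (u, a)) - kappa)%C <= e) ->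
  Cmod (Cint (fun y => f (c1, y)) a b - Cint (fun y => f (c0, y)) a b - kappa * (c1 - c0)%R)%C
  <= 2 * (e * (c1 - c0)).
Proof.
  intros Hc Hab Hd H He.
  assert (D : forall c, c0 <= c <= c1 -> forall u v, Rabs (u - c) < delta -> a - delta < v < b + delta -> is_C1 f df (u, v)).
  { intros c Hcc u v Hu Hv. apply H; [|exact Hv]. apply Rabs_lt_between' in Hu. lra. }
  eapply Rle_trans; [apply Cmod_le_Rabs|].
  assert (A1 := MVT_le (fun u => Re (Cint (fun y => f (u, y)) a b)) _ (Re kappa) e c0 c1 Hc
    (fun c Hcc => proj1 (is_derive_Cint_vertical f df c a b delta Hab Hd (D c Hcc)))
    (fun c Hcc => Rle_trans _ _ _ (Rabs_Re_le_Cmod (- Ci * (f (c, b) - f (c, a)) - kappa)%C) (He c Hcc))).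
  assert (A2 := MVT_le (fun u => Im (Cint (fun y => f (u, y)) a b)) _ (Im kappa) e c0 c1 Hc
    (fun c Hcc => proj2 (is_derive_Cint_vertical f df c a b delta Hab Hd (D c Hcc)))
    (fun c Hcc => Rle_trans _ _ _ (Rabs_Im_le_Cmod (- Ci * (f (c, b) - f (c, a)) - kappa)%C) (He c Hcc))).
  cbv beta in A1, A2.
  set (U1 := Cint (fun y => f (c1, y)) a b) in *. set (U0 := Cint (fun y => f (c0, y)) a b) in *.
  replace (Re (U1 - U0 - kappa * (c1 - c0)%R)%C) with (Re U1 - Re U0 - Re kappa * (c1 - c0)).
  replace (Im (U1 - U0 - kappa * (c1 - c0)%R)%C) with (Im U1 - Im U0 - Im kappa * (c1 - c0)).
  - lra.
  - destruct U1, U0, kappa; unfold Re, Im; simpl; ring.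
  - destruct U1, U0, kappa; unfold Re, Im; simpl; ring.
Qed.

(* On |y| >= eta there is no singularity and [Cint_strip] applies; the remaining
   segments |y| <= eta have length 2 eta. *)
Lemma Cint_cross (f df : C -> C) (q eta M T : R) :
  0 < eta -> eta < T -> 0 <= M ->
  (forall u v, q - 2 * eta < u < q + 2 * eta -> u <> q \/ v <> 0 -> is_C1 f df (u, v)) ->
  (forall u v, q - 2 * eta < u < q + 2 * eta -> - T <= v <= T -> u <> q \/ v <> 0 -> Cmod (f (u, v)) <= M) ->
  Cmod (Cint (fun y => f (q + eta, y)%R) (- T) T - Cint (fun y => f (q - eta, y)%R) (- T) T)%C
  <= 24 * M * eta.
Proof.
  intros He HT HM0 H HM.
  assert (Hex : forall c a b, c = q + eta \/ c = q - eta -> a <= b -> ex_Cint (fun y => f (c, y)) a b).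
  { intros c a b Hc Hab. apply (ex_Cint_C1 f df); [exact Hab|]. intros y _. apply H; [|left]; lra. }
  assert (Hsp : forall c, c = q + eta \/ c = q - eta ->
    Cint (fun y => f (c, y)) (- T) T =
    (Cint (fun y => f (c, y)) (- T) (- eta) + Cint (fun y => f (c, y)) (- eta) eta
     + Cint (fun y => f (c, y)) eta T)%C).
  { intros c Hc. rewrite !Cint_Chasles; try reflexivity; apply Hex; auto; lra. }
  (* The strip has width 2 eta and its boundary terms are at most 2 M; with the factor 2 of
     [Cint_strip] this gives 8 M eta. *)
  assert (Hside : forall a b, a <= b -> - T <= a -> b <= T -> (b <= - eta \/ eta <= a) ->
    Cmod (Cint (fun y => f (q + eta, y)%R) a b - Cint (fun y => f (q - eta, y)%R) a b)%C <= 8 * M * eta).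
  { intros a b Hab Ha Hb Hs.
    assert (S := Cint_strip f df 0 (2 * M) (q - eta) (q + eta) a b (eta / 2)).
    replace (Cint (fun y => f (q + eta, y)%R) a b - Cint (fun y => f (q - eta, y)%R) a b)%C
      with (Cint (fun y => f (q + eta, y)%R) a b - Cint (fun y => f (q - eta, y)%R) a b - 0 * (q + eta - (q - eta))%R)%C by ring.
    eapply Rle_trans; [apply S; try lra|].
    - intros u v Hu Hv. apply H; [|right]; lra.
    - intros u Hu.
      replace (- Ci * (f (u, b) - f (u, a)) - 0)%C with (Ci * (f (u, a) + - f (u, b)))%C by ring.
      rewrite Cmod_mult, Cmod_Ci, Rmult_1_l.
      eapply Rle_trans; [apply Cmod_triangle|]. rewrite Cmod_opp.
      assert (Cmod (f (u, a)) <= M) by (apply HM; [| |right]; lra).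
      assert (Cmod (f (u, b)) <= M) by (apply HM; [| |right]; lra). lra.
    - lra. }
  (* Length 2 eta, bound M and the factor 2 of [Cmod_Cint_le_const] give 4 M eta on each line. The
     total is 8 + 8 + 4 + 4 = 24. *)
  assert (Hmid : forall c, c = q + eta \/ c = q - eta ->
    Cmod (Cint (fun y => f (c, y)) (- eta) eta) <= 4 * M * eta).
  { intros c Hc. eapply Rle_trans; [apply (Cmod_Cint_le_const _ M); [lra|apply Hex; auto; lra|]|].
    - intros y Hy. apply HM; [| |left]; lra.
    - lra. }
  rewrite !Hsp by auto.
  set (A1 := Cint _ (- T) (- eta)). set (B1 := Cint _ (- eta) eta). set (C1 := Cint _ eta T).
  set (A0 := Cint (fun y => f (q - eta, y)) (- T) (- eta)).
  set (B0 := Cint (fun y => f (q - eta, y)) (- eta) eta).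
  set (C0 := Cint (fun y => f (q - eta, y)) eta T).
  replace (A1 + B1 + C1 - (A0 + B0 + C0))%C with ((A1 - A0) + (B1 + - B0) + (C1 - C0))%C by ring.
  eapply Rle_trans; [apply Cmod_triangle|].
  assert (Cmod (C1 - C0)%C <= 8 * M * eta) by (apply Hside; lra).
  assert (Cmod (A1 - A0 + (B1 + - B0))%C <= 16 * M * eta).
  { eapply Rle_trans; [apply Cmod_triangle|].
    assert (Cmod (A1 - A0)%C <= 8 * M * eta) by (apply Hside; lra).
    assert (Cmod (B1 + - B0)%C <= 8 * M * eta).
    { eapply Rle_trans; [apply Cmod_triangle|]. rewrite Cmod_opp.
      assert (Cmod B1 <= 4 * M * eta) by (apply Hmid; auto).
      assert (Cmod B0 <= 4 * M * eta) by (apply Hmid; auto). lra. }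
    lra. }
  lra.
Qed.

(** [kappa] is the approximate rate of change prescribed by the horizontal sides. The strip is cut
    at q - eta and q + eta; crossing the thin middle part costs O(eta), and eta is arbitrarily small
    while T is fixed, so [M] leaves no trace in the conclusion. *)
Lemma Cint_strip_removable (f df : C -> C) (kappa : C) (e c0 c1 q M T : R) :
  c0 < q < c1 -> 0 < T -> 0 <= M -> 0 < e ->
  (exists delta, 0 < delta /\
    forall u v, c0 - delta < u < c1 + delta -> u <> q \/ v <> 0 -> is_C1 f df (u, v)) ->
  (exists r, 0 < r /\ forall u v, q - r < u < q + r -> - T <= v <= T -> u <> q \/ v <> 0 -> Cmod (f (u, v)) <= M) ->
  (forall u, c0 <= u <= c1 -> Cmod (- Ci * (f (u, T) - f (u, - T)%R) - kappa)%C <= e) ->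
  Cmod (Cint (fun y => f (c1, y)) (- T) T - Cint (fun y => f (c0, y)) (- T) T - kappa * (c1 - c0)%R)%C
  <= 2 * (e * (c1 - c0)).
Proof.
  intros Hq HT HM He [delta [Hd H]] [r [Hr Hb]] Hk.
  apply le_epsilon. intros eps Heps.
  (* [Cint_cross] costs 24 M eta, and the part of [kappa * (c1 - c0)] over the omitted width costs 2
     |kappa| eta. The summand 1 keeps [K] positive. *)
  set (K := 24 * M + 2 * Cmod kappa + 1).
  assert (HK : 1 <= K) by (unfold K; generalize (Cmod_ge_0 kappa); lra).
  assert (Heta : exists eta, 0 < eta /\ eta < T /\ 2 * eta < r /\ 2 * eta < q - c0 /\ 2 * eta < c1 - q /\ K * eta <= eps).
  { set (m := Rmin (Rmin T r) (Rmin (Rmin (q - c0) (c1 - q)) (eps / K))).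
    assert (Hm : 0 < m).
    { unfold m. assert (0 < eps / K) by (apply Rdiv_lt_0_compat; lra).
      repeat apply Rmin_glb_lt; lra. }
    assert (m <= T /\ m <= r /\ m <= q - c0 /\ m <= c1 - q /\ m <= eps / K).
    { unfold m. repeat split.
      - eapply Rle_trans; [apply Rmin_l|apply Rmin_l].
      - eapply Rle_trans; [apply Rmin_l|apply Rmin_r].
      - eapply Rle_trans; [apply Rmin_r|]. eapply Rle_trans; [apply Rmin_l|apply Rmin_l].
      - eapply Rle_trans; [apply Rmin_r|]. eapply Rle_trans; [apply Rmin_l|apply Rmin_r].
      - eapply Rle_trans; [apply Rmin_r|apply Rmin_r]. }
    exists (m / 4). repeat split; try lra.
    apply (Rle_trans _ (K * (eps / K))); [apply Rmult_le_compat_l; lra|].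
    right. field. lra. }
  destruct Heta as [eta [E1 [E2 [E3 [E4 [E5 E6]]]]]].
  set (d := Rmin delta eta). assert (Hd1 : d <= delta) by apply Rmin_l.
  assert (Hd2 : d <= eta) by apply Rmin_r. assert (Hd0 : 0 < d) by (unfold d; apply Rmin_glb_lt; lra).
  assert (L1 := Cint_strip f df kappa e c0 (q - eta) (- T) T d).
  assert (L2 := Cint_strip f df kappa e (q + eta) c1 (- T) T d).
  assert (L3 := Cint_cross f df q eta M T).
  specialize (L1 ltac:(lra) ltac:(lra) Hd0).
  specialize (L2 ltac:(lra) ltac:(lra) Hd0).
  specialize (L3 ltac:(lra) ltac:(lra) HM).
  assert (G1 : Cmod (Cint (fun y => f (q - eta, y)%R) (- T) T - Cint (fun y => f (c0, y)) (- T) T - kappa * (q - eta - c0)%R)%C <= 2 * (e * (q - eta - c0))).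
  { apply L1.
    - intros u v Hu Hv. apply H; [|left]; lra.
    - intros u Hu. apply Hk. lra. }
  assert (G2 : Cmod (Cint (fun y => f (c1, y)%R) (- T) T - Cint (fun y => f (q + eta, y)%R) (- T) T - kappa * (c1 - (q + eta))%R)%C <= 2 * (e * (c1 - (q + eta)))).
  { apply L2.
    - intros u v Hu Hv. apply H; [|left]; lra.
    - intros u Hu. apply Hk. lra. }
  assert (G3 : Cmod (Cint (fun y => f (q + eta, y)%R) (- T) T - Cint (fun y => f (q - eta, y)%R) (- T) T)%C <= 24 * M * eta).
  { apply L3.
    - intros u v Hu Hv. apply H; [|exact Hv]; lra.
    - intros u v Hu Hv. apply Hb; [|exact Hv]; lra. }
  clear L1 L2 L3.
  set (U1 := Cint (fun y => f (c1, y)) (- T) T) in *. set (U0 := Cint (fun y => f (c0, y)) (- T) T) in *.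
  set (Up := Cint (fun y => f (q + eta, y)) (- T) T) in *. set (Um := Cint (fun y => f (q - eta, y)) (- T) T) in *.
  replace (U1 - U0 - kappa * (c1 - c0)%R)%C with
    ((U1 - Up - kappa * (c1 - (q + eta))%R) + ((Um - U0 - kappa * (q - eta - c0)%R) + ((Up - Um) + - (kappa * (2 * eta)%R))))%C.
  2:{ rewrite !RtoC_minus, ?RtoC_plus, ?RtoC_mult. ring. }
  eapply Rle_trans; [apply Cmod_triangle|].
  eapply Rle_trans; [apply Rplus_le_compat_l, Cmod_triangle|].
  eapply Rle_trans; [apply Rplus_le_compat_l, Rplus_le_compat_l, Cmod_triangle|].
  rewrite Cmod_opp, Cmod_mult, Cmod_R, (Rabs_pos_eq (2 * eta)) by lra.
  unfold K in E6. nra.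
Qed.

(** * Estimates for the cotangent and for powers *)

Lemma is_cderive_Cexp_scal (c u : C) :
  is_cderive (fun w => Cexp (c * w)%C) u (c * Cexp (c * u))%C.
Proof.
  eapply is_cderive_eq.
  - exact (is_cderive_comp Cexp (fun w => c * w)%C u _ _ (is_cderive_Cexp _)
      (is_cderive_scal c (fun w => w) u _ (is_cderive_id u))).
  - ring.
Qed.

Lemma is_cderive_Csin (u : C) : is_cderive Csin u (Ccos u).
Proof.
  apply (is_cderive_ext (fun w => / (2 * Ci) * (Cexp (Ci * w) + - (1) * Cexp (- Ci * w)))%C).
  { intros w. unfold Csin. replace (- Ci * w)%C with (- (Ci * w))%C by ring. unfold Cdiv. ring. }
  eapply is_cderive_eq.
  - exact (is_cderive_scal _ _ _ _ (is_cderive_plus _ _ _ _ _ (is_cderive_Cexp_scal Ci u)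
      (is_cderive_scal _ _ _ _ (is_cderive_Cexp_scal (- Ci)%C u)))).
  - unfold Ccos. replace (- Ci * u)%C with (- (Ci * u))%C by ring. field. apply Ci_neq0.
Qed.

Lemma is_cderive_Ccos (u : C) : is_cderive Ccos u (- Csin u)%C.
Proof.
  apply (is_cderive_ext (fun w => / 2 * (Cexp (Ci * w) + Cexp (- Ci * w)))%C).
  { intros w. unfold Ccos. replace (- Ci * w)%C with (- (Ci * w))%C by ring. unfold Cdiv. ring. }
  eapply is_cderive_eq.
  - exact (is_cderive_scal _ _ _ _ (is_cderive_plus _ _ _ _ _ (is_cderive_Cexp_scal Ci u)
      (is_cderive_Cexp_scal (- Ci)%C u))).
  - unfold Csin. replace (- Ci * u)%C with (- (Ci * u))%C by ring.
    transitivity (Ci * Ci * (Cexp (Ci * u) - Cexp (- (Ci * u))) / (2 * Ci))%C.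
    + field. apply Ci_neq0.
    + rewrite Ci_sqr. field. apply Ci_neq0.
Qed.

Lemma is_cderive_Ccot (u : C) : Csin u <> 0%C -> is_cderive Ccot u (- / (Csin u * Csin u))%C.
Proof.
  intros H. eapply is_cderive_eq.
  - apply (is_cderive_mult Ccos (fun w => / Csin w)%C).
    + apply is_cderive_Ccos.
    + apply (is_cderive_comp Cinv Csin); [now apply is_cderive_Cinv|apply is_cderive_Csin].
  - transitivity (- (Csin u * Csin u + Ccos u * Ccos u) / (Csin u * Csin u))%C.
    + field. exact H.
    + rewrite Ccos_sqr. field. exact H.
Qed.

Lemma ccontinuous_Csin (f : C -> C) (z : C) : ccontinuous f z -> ccontinuous (fun w => Csin (f w)) z.
Proof.
  intros H. unfold Csin, Cdiv. apply ccontinuous_mult; [|apply ccontinuous_const].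
  apply ccontinuous_minus; apply ccontinuous_Cexp; [|apply ccontinuous_opp];
  (apply ccontinuous_mult; [apply ccontinuous_const|exact H]).
Qed.

Lemma ccontinuous_Ccos (f : C -> C) (z : C) : ccontinuous f z -> ccontinuous (fun w => Ccos (f w)) z.
Proof.
  intros H. unfold Ccos, Cdiv. apply ccontinuous_mult; [|apply ccontinuous_const].
  apply ccontinuous_plus; apply ccontinuous_Cexp; [|apply ccontinuous_opp];
  (apply ccontinuous_mult; [apply ccontinuous_const|exact H]).
Qed.

Lemma ccontinuous_Ccot (f : C -> C) (z : C) :
  Csin (f z) <> 0%C -> ccontinuous f z -> ccontinuous (fun w => Ccot (f w)) z.
Proof.
  intros Hs H. unfold Ccot, Cdiv. apply ccontinuous_mult; [now apply ccontinuous_Ccos|].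
  apply ccontinuous_Cinv; [exact Hs|now apply ccontinuous_Csin].
Qed.

Lemma ccontinuous_affine (p z : C) : ccontinuous (fun w => PI * (w - p))%C z.
Proof.
  apply ccontinuous_mult; [apply ccontinuous_const|].
  apply ccontinuous_minus; [apply ccontinuous_id|apply ccontinuous_const].
Qed.

Lemma is_cderive_Ccot_affine (p z : C) : Csin (PI * (z - p))%C <> 0%C ->
  is_cderive (fun w => Ccot (PI * (w - p))%C) z (- PI * / (Csin (PI * (z - p)) * Csin (PI * (z - p))))%C.
Proof.
  intros H. eapply is_cderive_eq.
  - apply (is_cderive_comp Ccot); [now apply is_cderive_Ccot|].
    apply is_cderive_scal, is_cderive_plus; [apply is_cderive_id|apply is_cderive_const].
  - ring.
Qed.

Lemma Csin_PI_neq0 (p x y : R) :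
  (forall j : Z, x <> p + IZR j) \/ y <> 0 -> Csin (PI * ((x, y) - p))%C <> 0%C.
Proof.
  intros H. replace (PI * ((x, y) - p))%C with (PI * (x - p), PI * y).
  2:{ apply C_ext; simpl; ring. }
  generalize PI_RGT_0. intros HP.
  apply Csin_neq0. destruct H as [H|H].
  - left. intros E. apply sin_eq_0_0 in E. destruct E as [j E]. apply (H j).
    apply (Rmult_eq_reg_l PI); lra.
  - right. intros E. apply Rmult_integral in E. lra.
Qed.

Lemma IZR_between_1 (j : Z) : -1 < IZR j < 1 -> IZR j = 0.
Proof. intros [H1 H2]. apply lt_IZR in H1. apply lt_IZR in H2. now replace j with 0%Z by lia. Qed.

Lemma Csin_PI_neq0_near (q x y : R) :
  q - 1 < x < q + 1 -> x <> q \/ y <> 0 -> Csin (PI * ((x, y) - q))%C <> 0%C.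
Proof.
  intros Hx [H|H]; apply Csin_PI_neq0; [left|now right].
  intros j E. assert (IZR j = 0) by (apply IZR_between_1; lra). lra.
Qed.

Lemma Cmod_le_of_sqr (z : C) (m : R) : 0 <= m -> Cmod z ^ 2 <= m ^ 2 -> Cmod z <= m.
Proof. intros Hm H. generalize (Cmod_ge_0 z). nra. Qed.

(** The squared modulus is (cos^2 x + sinh^2 y) / (sin^2 x + sinh^2 y). The bound is uniform in y,
    so on a vertical line without poles the decay of the integrand comes from the power alone. *)
Lemma Cmod_Ccot_le (x y : R) : sin x <> 0 -> Cmod (Ccot (x, y)) <= / Rabs (sin x).
Proof.
  intros H. assert (Hs : Csin (x, y) <> 0%C) by (apply Csin_neq0; now left).
  assert (Hx : 0 < Rabs (sin x)) by now apply Rabs_pos_lt.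
  unfold Ccot. rewrite Cmod_div by exact Hs.
  assert (0 < Cmod (Csin (x, y))) by now apply Cmod_gt_0.
  apply (Rmult_le_reg_r (Cmod (Csin (x, y)))); [assumption|].
  unfold Rdiv. rewrite Rmult_assoc, Rinv_l by lra. rewrite Rmult_1_r.
  apply (Rmult_le_reg_l (Rabs (sin x))); [assumption|].
  rewrite <- Rmult_assoc, Rinv_r, Rmult_1_l by lra.
  assert (Hsq : Rabs (sin x) ^ 2 = sin x ^ 2) by apply pow2_abs.
  assert (A : (Rabs (sin x) * Cmod (Ccos (x, y))) ^ 2 <= Cmod (Csin (x, y)) ^ 2).
  { rewrite Rpow_mult_distr, Hsq, Cmod_Ccos_sqr, Cmod_Csin_sqr.
    assert (E1 := sin_sqr x). assert (0 <= cos x ^ 2) by apply pow2_ge_0.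
    assert (0 <= sinh y ^ 2) by apply pow2_ge_0. assert (0 <= sin x ^ 2) by apply pow2_ge_0. nra. }
  assert (0 <= Cmod (Ccos (x, y))) by apply Cmod_ge_0. nra.
Qed.

Lemma Ccot_plus_Ci (u : C) : Csin u <> 0%C -> (Ccot u + Ci = Cexp (Ci * u) / Csin u)%C.
Proof.
  intros H. unfold Ccot. transitivity ((Ccos u + Ci * Csin u) / Csin u)%C; [field; exact H|].
  f_equal. unfold Ccos, Csin. field. apply Ci_neq0.
Qed.

Lemma Cmod_Csin_ge (x y : R) : Rabs y <= Cmod (Csin (x, y)).
Proof.
  generalize (Cmod_Csin_sqr x y), (sinh_sqr_ge y), (pow2_ge_0 (sin x)), (Cmod_ge_0 (Csin (x, y))), (pow2_abs y), (Rabs_pos y).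
  intros. nra.
Qed.

(** Since cot u + i = exp(iu) / sin u, it suffices that |exp(iu)| <= 1 and |sin u| >= y. The true
    decay is exponential, but errors of order 1/T are good enough for the shift. *)
Lemma Ccot_upper (x y : R) : 0 < y -> Cmod (Ccot (x, y) + Ci)%C <= / y.
Proof.
  intros Hy. assert (Hs : Csin (x, y) <> 0%C) by (apply Csin_neq0; right; lra).
  rewrite Ccot_plus_Ci by exact Hs. rewrite Cmod_div by exact Hs. rewrite Cmod_Cexp.
  generalize (Cmod_Csin_ge x y). rewrite Rabs_pos_eq by lra. intros H.
  replace (Re (Ci * (x, y))%C) with (- y) by (simpl; ring).
  assert (E : exp (- y) <= 1) by (rewrite <- exp_0; left; apply exp_increasing; lra).
  unfold Rdiv. rewrite <- (Rmult_1_l (/ y)).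
  apply Rmult_le_compat; [left; apply exp_pos| |exact E|].
  - left. apply Rinv_0_lt_compat. lra.
  - now apply Rinv_le_contravar.
Qed.

Lemma Ccot_lower (x y : R) : 0 < y -> Cmod (Ccot (x, - y)%R - Ci)%C <= / y.
Proof.
  intros Hy. generalize (Ccot_upper (- x) y Hy).
  replace (- x, y) with (- (x, - y)%R)%C by (apply C_ext; simpl; ring).
  rewrite Ccot_opp by (apply Csin_neq0; right; lra).
  rewrite <- (Cmod_opp (- _ + Ci)%C). intros H. eapply Rle_trans; [|exact H]. right. f_equal. ring.
Qed.

Lemma sin_ge_half : exists r, 0 < r /\ forall x, Rabs x < r -> Rabs x / 2 <= Rabs (sin x).
Proof.
  assert (D := derivable_pt_lim_sin 0). rewrite cos_0 in D.
  destruct (D (1/2) ltac:(lra)) as [r Hr]. exists r. split; [apply cond_pos|].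
  intros x Hx. destruct (Req_dec x 0) as [->|H0]; [rewrite sin_0, Rabs_R0; lra|].
  specialize (Hr x H0 Hx). rewrite Rplus_0_l, sin_0, Rminus_0_r in Hr.
  assert (H1 : 1 / 2 <= Rabs (sin x / x)).
  { generalize (Rabs_triang_inv 1 (1 - sin x / x)). rewrite (Rabs_minus_sym 1), Rabs_R1.
    replace (1 - (1 - sin x / x)) with (sin x / x) by ring.
    intros. lra. }
  assert (Hp : 0 < Rabs x) by now apply Rabs_pos_lt.
  replace (sin x) with (sin x / x * x) by (field; exact H0). rewrite Rabs_mult. nra.
Qed.

(** For small x, |sin z|^2 = sin^2 x + sinh^2 y is at least |z|^2 / 4, while |cos z| <= cosh S. Only
    x has to be small: the bound must hold along a whole vertical segment. *)
Lemma Ccot_near_0 : exists r, 0 < r /\ forall x y S, Rabs x < r -> Rabs y <= S -> x <> 0 \/ y <> 0 ->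
  Cmod (Ccot (x, y)) <= 2 * cosh S / Cmod (x, y).
Proof.
  destruct sin_ge_half as [r [Hr Hs]]. exists r. split; [exact Hr|].
  intros x y S Hx Hy Hxy.
  assert (H1 : Cmod (x, y) / 2 <= Cmod (Csin (x, y))).
  { specialize (Hs x Hx). generalize (Cmod2_alt (x, y)), (Cmod_Csin_sqr x y), (sinh_sqr_ge y),
      (Cmod_ge_0 (x, y)), (Cmod_ge_0 (Csin (x, y))), (pow2_abs x), (pow2_abs (sin x)), (Rabs_pos x), (Rabs_pos (sin x)).
    unfold Re, Im; simpl fst; simpl snd. intros. nra. }
  assert (Hz : 0 < Cmod (x, y)).
  { apply Cmod_gt_0. intros E. injection E. lra. }
  assert (HS : 0 < cosh S) by (unfold cosh; generalize (exp_pos S), (exp_pos (- S)); lra).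
  assert (H2 : Cmod (Ccos (x, y)) <= cosh S).
  { apply Cmod_le_of_sqr; [lra|]. rewrite Cmod_Ccos_sqr, cosh_sqr.
    assert (cos x ^ 2 <= 1) by (generalize (sin_sqr x), (pow2_ge_0 (sin x)); lra).
    assert (sinh y ^ 2 <= sinh S ^ 2).
    { assert (E : forall t, sinh t ^ 2 = sinh (Rabs t) ^ 2).
      { intros t. unfold Rabs. destruct (Rcase_abs t); [|reflexivity].
        replace (sinh (- t)) with (- sinh t) by (unfold sinh; rewrite Ropp_involutive; lra). ring. }
      rewrite (E y). generalize (Rabs_pos y). intros Hp.
      assert (0 <= sinh (Rabs y)) by (generalize (sinh_ge _ Hp); lra).
      assert (sinh (Rabs y) <= sinh S).
      { destruct Hy as [Hy|Hy]; [|right; now rewrite Hy].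
        unfold sinh. generalize (exp_increasing _ _ Hy). assert (H3 : - S < - Rabs y) by lra.
        generalize (exp_increasing _ _ H3). lra. }
      apply pow_incr. split; assumption. }
    lra. }
  assert (Hsn : Csin (x, y) <> 0%C) by (intros E; rewrite E, Cmod_0 in H1; lra).
  unfold Ccot. rewrite Cmod_div by exact Hsn.
  replace (2 * cosh S / Cmod (x, y)) with (cosh S * / (Cmod (x, y) / 2)) by (field; lra).
  apply Rmult_le_compat; [apply Cmod_ge_0| |exact H2|].
  - left. apply Rinv_0_lt_compat. lra.
  - apply Rinv_le_contravar; lra.
Qed.

Lemma Rpower_neg_le (x y s : R) : 0 <= s -> 0 < x <= y -> Rpower y (- s) <= Rpower x (- s).
Proof.
  intros Hs Hx. rewrite !Rpower_Ropp. apply Rinv_le_contravar; [apply exp_pos|].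
  now apply Rle_Rpower_l.
Qed.

Definition power_const (a : C) : R := exp (Rabs (Im a) * PI).

Lemma Cmod_Cpower_neg_le (a z : C) : 0 < Re z ->
  Cmod (Cpower z (- a)%C) <= power_const a * Rpower (Cmod z) (- Re a).
Proof.
  intros H. eapply Rle_trans; [now apply Cmod_Cpower_le|].
  destruct a as [s t]. unfold power_const. simpl. rewrite Rabs_Ropp. lra.
Qed.

(** The mean value theorem along the segment from w to z, which stays in Re >= r. It makes z^(-a) -
    q^(-a) small enough to compensate the simple pole of the cotangent at q. *)
Lemma Cpower_Lipschitz (a : C) (r : R) : 0 < r -> 0 <= Re a ->
  exists K, 0 <= K /\ forall z w, r <= Re z -> r <= Re w ->
    Cmod (Cpower z (- a) - Cpower w (- a))%C <= K * Cmod (z - w)%C.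
Proof.
  intros Hr Ha. set (K := Cmod a * (power_const (a + 1)%C * Rpower r (- Re (a + 1)%C))).
  assert (HK : 0 <= K).
  { apply Rmult_le_pos; [apply Cmod_ge_0|]. apply Rmult_le_pos; left; apply exp_pos. }
  exists (2 * K). split; [lra|]. intros z w Hz Hw.
  set (g := fun t : R => (w + t * (z - w))%C).
  assert (Hg : forall t, 0 <= t <= 1 -> r <= Re (g t)).
  { intros t Ht. unfold g. destruct z as [x y], w as [x' y']. simpl in *.
    replace (x' + (t * (x + - x') - 0 * (y + - y'))) with ((1 - t) * x' + t * x) by ring. nra. }
  set (dg := fun t => (- a * Cpower (g t) (- a - 1) * (z - w))%C).
  assert (D : forall t, 0 <= t <= 1 -> is_path_derive (fun s => Cpower (g s) (- a)%C) t (dg t)).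
  { intros t Ht. apply (is_cderive_Cpower (- a)%C (g t)).
    - specialize (Hg t Ht). lra.
    - reflexivity.
    - unfold g. destruct z as [x y], w as [x' y']. split; simpl.
      + auto_derive; [exact I|]. ring.
      + auto_derive; [exact I|]. ring. }
  assert (B : forall t, 0 <= t <= 1 -> Cmod (dg t) <= K * Cmod (z - w)%C).
  { intros t Ht. specialize (Hg t Ht). unfold dg. rewrite !Cmod_mult, Cmod_opp.
    apply Rmult_le_compat_r; [apply Cmod_ge_0|]. unfold K.
    apply Rmult_le_compat_l; [apply Cmod_ge_0|].
    replace (- a - 1)%C with (- (a + 1))%C by ring.
    eapply Rle_trans; [apply Cmod_Cpower_neg_le; lra|].
    apply Rmult_le_compat_l; [left; apply exp_pos|].
    apply Rpower_neg_le; [change (0 <= Re a + 1); lra|]. split; [exact Hr|].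
    eapply Rle_trans; [exact Hg|]. eapply Rle_trans; [apply Rle_abs|apply Rabs_Re_le_Cmod]. }
  assert (A1 := MVT_le (fun s => Re (Cpower (g s) (- a)%C)) (fun t => Re (dg t)) 0 (K * Cmod (z - w)%C) 0 1 ltac:(lra)
    (fun t Ht => proj1 (D t Ht))).
  assert (A2 := MVT_le (fun s => Im (Cpower (g s) (- a)%C)) (fun t => Im (dg t)) 0 (K * Cmod (z - w)%C) 0 1 ltac:(lra)
    (fun t Ht => proj2 (D t Ht))).
  assert (g0 : g 0 = w) by (unfold g; ring). assert (g1 : g 1 = z) by (unfold g; ring).
  cbv beta in A1, A2. rewrite g0, g1 in A1, A2.
  assert (B1 : Rabs (Re (Cpower z (- a)%C) - Re (Cpower w (- a)%C) - 0 * (1 - 0)) <= K * Cmod (z - w)%C * (1 - 0)).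
  { apply A1. intros c Hc. rewrite Rminus_0_r. eapply Rle_trans; [apply Rabs_Re_le_Cmod|now apply B]. }
  assert (B2 : Rabs (Im (Cpower z (- a)%C) - Im (Cpower w (- a)%C) - 0 * (1 - 0)) <= K * Cmod (z - w)%C * (1 - 0)).
  { apply A2. intros c Hc. rewrite Rminus_0_r. eapply Rle_trans; [apply Rabs_Im_le_Cmod|now apply B]. }
  eapply Rle_trans; [apply Cmod_le_Rabs|].
  set (P := Cpower z (- a)%C) in *. set (Q := Cpower w (- a)%C) in *.
  replace (Re (P - Q)%C) with (Re P - Re Q - 0 * (1 - 0)) by (destruct P, Q; simpl; ring).
  replace (Im (P - Q)%C) with (Im P - Im Q - 0 * (1 - 0)) by (destruct P, Q; simpl; ring).
  lra.
Qed.

(** * Integrals of cot(pi (z - p)) z^(-a) *)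

Definition cot_power (a : C) (p : R) (z : C) : C :=
  (Ccot (PI * (z - p)) * Cpower z (- a))%C.

Lemma ex_Cint_ccontinuous (f : C -> C) (x a b : R) :
  (forall y, ccontinuous f (x, y)) -> ex_Cint (fun y => f (x, y)) a b.
Proof. intros H. apply ex_Cint_continuous. intros y _. now apply ccontinuous_vertical. Qed.

Lemma ccontinuous_cot_power (a : C) (p x y : R) :
  0 < x -> Csin (PI * ((x, y) - p))%C <> 0%C -> ccontinuous (cot_power a p) (x, y).
Proof.
  intros Hx Hs. apply ccontinuous_mult; [|now apply ccontinuous_Cpower].
  apply ccontinuous_Ccot; [exact Hs|apply ccontinuous_affine].
Qed.

Lemma Cmod_Cpower_neg_ge (a : C) (u v T : R) :
  1 <= Re a -> 0 < u -> 1 <= T <= Rabs v -> Cmod (Cpower (u, v) (- a)%C) <= power_const a / T.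
Proof.
  intros Ha Hu HT. eapply Rle_trans; [now apply Cmod_Cpower_neg_le|].
  unfold Rdiv. apply Rmult_le_compat_l; [left; apply exp_pos|].
  eapply Rle_trans.
  - apply (Rpower_neg_le T); [lra|]. split; [lra|].
    eapply Rle_trans; [apply HT|]. exact (Rabs_Im_le_Cmod (u, v)).
  - rewrite <- (Rpower_1 T) at 2 by lra. rewrite <- Rpower_Ropp. apply Rle_Rpower; lra.
Qed.

(** The limit 2 q^(-a) is 2 pi i times the residue q^(-a) / pi, divided by i because the integral is
    in y. It arises as the rate [kappa] of [Cint_strip_removable] for the regularized function
    [psi], over a strip of width 1. *)
Lemma cot_power_shift (a : C) (c q : R) : 1 <= Re a -> 0 < c -> c < q < c + 1 ->
  exists K, forall T, 1 <= T ->
    Cmod (Cint (fun y => cot_power a q (c + 1, y)%R) (- T) T - Cint (fun y => cot_power a q (c, y)) (- T) T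
          - 2 * Cpower q (- a))%C <= K / T.
Proof.
  intros Ha Hc Hq.
  set (fq := Cpower q (- a)%C). set (P := power_const a).
  set (psi := fun z => (Ccot (PI * (z - q)) * (Cpower z (- a) + - fq))%C).
  set (dpsi := fun z => (- PI * / (Csin (PI * (z - q)) * Csin (PI * (z - q))) * (Cpower z (- a) + - fq)
    + Ccot (PI * (z - q)) * (- a * Cpower z (- a - 1) + 0))%C).
  assert (HP : 0 < P) by apply exp_pos. assert (HPI := PI_RGT_0).
  assert (HC1 : forall u v, 0 < u -> q - 1 < u < q + 1 -> u <> q \/ v <> 0 -> is_C1 psi dpsi (u, v)).
  { intros u v Hu0 Hu Hv. assert (Hs := Csin_PI_neq0_near q u v Hu Hv). split.
    - exact (is_cderive_mult _ _ _ _ _ (is_cderive_Ccot_affine q (u, v) Hs)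
        (is_cderive_plus _ _ _ _ _ (is_cderive_Cpower (- a)%C (u, v) Hu0) (is_cderive_const (- fq)%C (u, v)))).
    - unfold dpsi. apply ccontinuous_plus; apply ccontinuous_mult.
      + apply ccontinuous_mult; [apply ccontinuous_const|].
        apply ccontinuous_Cinv; [now apply Cmult_neq_0|].
        apply ccontinuous_mult; apply ccontinuous_Csin, ccontinuous_affine.
      + apply ccontinuous_plus; [now apply ccontinuous_Cpower|apply ccontinuous_const].
      + apply ccontinuous_Ccot; [exact Hs|apply ccontinuous_affine].
      + apply ccontinuous_plus; [|apply ccontinuous_const].
        apply ccontinuous_mult; [apply ccontinuous_const|now apply ccontinuous_Cpower]. }
  destruct (Cpower_Lipschitz a c Hc ltac:(lra)) as [L [HL0 HL]].
  destruct Ccot_near_0 as [r0 [Hr0 Hcot]].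
  (* The two powers contribute 2 P / T and the two deviations of the cotangent from its limits 2 (P
     + |fq|) / T; the outer factor 2 is that of [Cint_strip_removable]. *)
  exists (2 * (4 * P + 2 * Cmod fq)). intros T HT.
  assert (Hred : (Cint (fun y => cot_power a q (c + 1, y)%R) (- T) T - Cint (fun y => cot_power a q (c, y)) (- T) T
    = Cint (fun y => psi (c + 1, y)%R) (- T) T - Cint (fun y => psi (c, y)) (- T) T)%C).
  { assert (E : forall x, 0 < x -> (forall y, Csin (PI * ((x, y) - q))%C <> 0%C) ->
      Cint (fun y => psi (x, y)) (- T) T =
      (Cint (fun y => cot_power a q (x, y)) (- T) T + - fq * Cint (fun y => Ccot (PI * ((x, y) - q))%C) (- T) T)%C).
    { intros x Hx Hs.
      assert (X : ex_Cint (fun y => Ccot (PI * ((x, y) - q))%C) (- T) T).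
      { apply (ex_Cint_ccontinuous (fun z => Ccot (PI * (z - q))%C)). intros y.
        apply ccontinuous_Ccot; [apply Hs|apply ccontinuous_affine]. }
      rewrite <- Cint_scal by exact X. rewrite <- Cint_plus.
      - apply Cint_ext. intros y. unfold psi, cot_power. ring.
      - apply ex_Cint_ccontinuous. intros y. now apply ccontinuous_cot_power.
      - now apply ex_Cint_scal. }
    rewrite (E c), (E (c + 1)); try lra.
    2,3: intros y; apply Csin_PI_neq0_near; [|left]; lra.
    rewrite (Cint_ext (fun y => Ccot (PI * ((c + 1, y)%R - q))%C) (fun y => Ccot (PI * ((c, y) - q))%C)).
    - ring.
    - intros y. rewrite <- (Ccot_plus_PI (PI * ((c, y) - q))). f_equal. apply C_ext; simpl; ring. }
  rewrite Hred.
  replace (2 * fq)%C with (2 * fq * (c + 1 - c)%R)%C.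
  2:{ replace (c + 1 - c) with 1 by ring. ring. }
  replace (2 * (4 * P + 2 * Cmod fq) / T) with (2 * ((4 * P + 2 * Cmod fq) / T * (c + 1 - c))) by (field; lra).
  (* This bound for [psi] near q grows with T, which is harmless because it does not enter the final
     estimate. *)
  assert (HM : 0 <= 2 * cosh (PI * T) / PI * L).
  { apply Rmult_le_pos; [|exact HL0]. unfold cosh. left.
    generalize (exp_pos (PI * T)), (exp_pos (- (PI * T))). intros. apply Rdiv_lt_0_compat; lra. }
  apply (Cint_strip_removable psi dpsi (2 * fq)%C _ c (c + 1) q (2 * cosh (PI * T) / PI * L)); try lra.
  - apply Rdiv_lt_0_compat; [|lra]. generalize (Cmod_ge_0 fq). lra.
  - exists (Rmin c (Rmin (q - c) (c + 1 - q))).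
    assert (A1 := Rmin_l c (Rmin (q - c) (c + 1 - q))).
    assert (A2 := Rmin_r c (Rmin (q - c) (c + 1 - q))).
    assert (A3 := Rmin_l (q - c) (c + 1 - q)). assert (A4 := Rmin_r (q - c) (c + 1 - q)).
    split; [repeat apply Rmin_glb_lt; lra|].
    intros u v Hu Hv. apply HC1; [lra|lra|exact Hv].
  - exists (Rmin (r0 / PI) (q - c)).
    assert (A1 := Rmin_l (r0 / PI) (q - c)). assert (A2 := Rmin_r (r0 / PI) (q - c)).
    split.
    { apply Rmin_glb_lt; [apply Rdiv_lt_0_compat; lra|lra]. }
    intros u v Hu Hv Huv. unfold psi. rewrite Cmod_mult.
    assert (Hz : 0 < Cmod ((u, v) - q)%C).
    { apply Cmod_gt_0. intros E. injection E. intros. lra. }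
    assert (H1 : Cmod (Ccot (PI * ((u, v) - q))%C) <= 2 * cosh (PI * T) / (PI * Cmod ((u, v) - q)%C)).
    { replace (PI * Cmod ((u, v) - q)%C) with (Cmod (PI * (u - q), PI * v)).
      - replace (PI * ((u, v) - q))%C with (PI * (u - q), PI * v) by (apply C_ext; simpl; ring).
        apply Hcot.
        + rewrite Rabs_mult, (Rabs_pos_eq PI) by lra.
          assert (Rabs (u - q) < r0 / PI) by (apply Rabs_def1; lra).
          apply (Rmult_lt_reg_r (/ PI)); [now apply Rinv_0_lt_compat|].
          replace (PI * Rabs (u - q) * / PI) with (Rabs (u - q)) by (field; lra). exact H.
        + rewrite Rabs_mult, (Rabs_pos_eq PI) by lra. apply Rmult_le_compat_l; [lra|]. apply Rabs_le. lra.
        + destruct Huv as [H|H]; [left|right]; intros E; apply Rmult_integral in E; lra.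
      - rewrite <- (Rabs_pos_eq PI) at 3 by lra. rewrite <- Cmod_R, <- Cmod_mult. f_equal. apply C_ext; simpl; ring. }
    assert (H2 : Cmod (Cpower (u, v) (- a) + - fq)%C <= L * Cmod ((u, v) - q)%C).
    { apply (HL (u, v) q); simpl; lra. }
    replace (2 * cosh (PI * T) / PI * L) with (2 * cosh (PI * T) / (PI * Cmod ((u, v) - q)%C) * (L * Cmod ((u, v) - q)%C)) by (field; lra).
    apply Rmult_le_compat; auto using Cmod_ge_0.
  - intros u Hu. unfold psi.
    set (d1 := (Ccot (PI * ((u, T) - q)) + Ci)%C). set (d2 := (Ccot (PI * ((u, - T)%R - q)) - Ci)%C).
    set (f1 := Cpower (u, T) (- a)%C). set (f2 := Cpower (u, - T)%R (- a)%C).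
    assert (HT1 : / (PI * T) <= / T).
    { apply Rinv_le_contravar; [lra|]. assert (1 < PI) by (generalize PI2_1; lra). nra. }
    assert (B1 : Cmod d1 <= / T).
    { unfold d1. replace (PI * ((u, T) - q))%C with (PI * (u - q), PI * T) by (apply C_ext; simpl; ring).
      eapply Rle_trans; [apply Ccot_upper; nra|exact HT1]. }
    assert (B2 : Cmod d2 <= / T).
    { unfold d2. replace (PI * ((u, - T)%R - q))%C with (PI * (u - q), - (PI * T)) by (apply C_ext; simpl; ring).
      eapply Rle_trans; [apply Ccot_lower; nra|exact HT1]. }
    assert (B3 : Cmod f1 <= P / T) by (apply Cmod_Cpower_neg_ge; [exact Ha|lra|rewrite Rabs_pos_eq; lra]).
    assert (B4 : Cmod f2 <= P / T) by (apply Cmod_Cpower_neg_ge; [exact Ha|lra|rewrite Rabs_Ropp, Rabs_pos_eq; lra]).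
    assert (HPT : P / T <= P).
    { rewrite <- (Rmult_1_r P) at 2. apply Rmult_le_compat_l; [lra|]. rewrite <- Rinv_1. apply Rinv_le_contravar; lra. }
    (* With cot = -i + d1 at the top and cot = i + d2 at the bottom, the constant parts give exactly
       2 fq - f1 - f2; everything left is O(1/T). *)
    replace (- Ci * (Ccot (PI * ((u, T) - q)) * (f1 + - fq) - Ccot (PI * ((u, (- T)%R) - q)) * (f2 + - fq)) - 2 * fq)%C
      with ((- f1 + - f2) + (- Ci * (d1 * (f1 + - fq)) + Ci * (d2 * (f2 + - fq))))%C.
    2:{ unfold d1, d2. set (c1 := Ccot _). set (c2 := Ccot _).
        transitivity (- f1 + - f2 + (- Ci * (c1 * (f1 + - fq)) + Ci * (c2 * (f2 + - fq)) - Ci * Ci * (f1 + - fq) - Ci * Ci * (f2 + - fq)))%C; [ring|].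
        rewrite Ci_sqr. ring. }
    assert (HTi : 0 < / T) by (apply Rinv_0_lt_compat; lra).
    assert (G : forall d f, Cmod d <= / T -> Cmod f <= P / T -> Cmod (d * (f + - fq))%C <= / T * (P + Cmod fq)).
    { intros d f Hd Hf. rewrite Cmod_mult. apply Rmult_le_compat; auto using Cmod_ge_0.
      eapply Rle_trans; [apply Cmod_triangle|]. rewrite Cmod_opp. lra. }
    eapply Rle_trans; [apply Cmod_triangle|].
    eapply Rle_trans; [apply Rplus_le_compat; apply Cmod_triangle|].
    rewrite !(Cmod_mult (- Ci)%C), !(Cmod_mult Ci), !Cmod_opp, Cmod_Ci, !Rmult_1_l.
    generalize (G d1 f1 B1 B3), (G d2 f2 B2 B4). unfold Rdiv in *. intros G1 G2. nra.
Qed.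

(** * Limits at infinity *)

Definition tends (F : R -> C) (l : C) : Prop :=
  forall e, 0 < e -> exists A, forall T, A <= T -> Cmod (F T - l)%C <= e.

Lemma tends_ext (F G : R -> C) (l : C) : (forall T, F T = G T) -> tends F l -> tends G l.
Proof. intros E H e He. destruct (H e He) as [A HA]. exists A. intros T HT. rewrite <- E. auto. Qed.

Lemma tends_plus (F G : R -> C) (l m : C) : tends F l -> tends G m -> tends (fun T => F T + G T)%C (l + m)%C.
Proof.
  intros HF HG e He. destruct (HF (e / 2) ltac:(lra)) as [A HA], (HG (e / 2) ltac:(lra)) as [B HB].
  exists (Rmax A B). intros T HT.
  replace (F T + G T - (l + m))%C with ((F T - l) + (G T - m))%C by ring.
  eapply Rle_trans; [apply Cmod_triangle|].
  assert (Cmod (F T - l)%C <= e / 2) by (apply HA; eapply Rle_trans; [apply Rmax_l|exact HT]).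
  assert (Cmod (G T - m)%C <= e / 2) by (apply HB; eapply Rle_trans; [apply Rmax_r|exact HT]).
  lra.
Qed.

Lemma tends_scal (c : C) (F : R -> C) (l : C) : tends F l -> tends (fun T => c * F T)%C (c * l)%C.
Proof.
  intros H e He. set (k := Cmod c + 1). assert (Hk : 0 < k) by (unfold k; generalize (Cmod_ge_0 c); lra).
  destruct (H (e / k) ltac:(now apply Rdiv_lt_0_compat)) as [A HA]. exists A. intros T HT. specialize (HA T HT).
  replace (c * F T - c * l)%C with (c * (F T - l))%C by ring. rewrite Cmod_mult.
  apply (Rle_trans _ (k * (e / k))).
  - apply Rmult_le_compat; auto using Cmod_ge_0. unfold k. lra.
  - right. field. lra.
Qed.

Lemma tends_const (c : C) : tends (fun _ => c) c.
Proof. intros e He. exists 0. intros T _. replace (c - c)%C with (RtoC 0) by ring. rewrite Cmod_0. lra. Qed.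

Lemma Cmod_small_eq (z w : C) : (forall e, 0 < e -> Cmod (z - w)%C <= e) -> z = w.
Proof.
  intros H. assert (E : Cmod (z - w)%C = 0).
  { apply Rle_antisym; [|apply Cmod_ge_0]. apply le_epsilon. intros e He. rewrite Rplus_0_l. now apply H. }
  apply Cmod_eq_0 in E. replace z with ((z - w) + w)%C by ring. rewrite E. ring.
Qed.

Lemma tends_unique (F : R -> C) (l m : C) : tends F l -> tends F m -> l = m.
Proof.
  intros H1 H2. apply Cmod_small_eq. intros e He.
  destruct (H1 (e / 2) ltac:(lra)) as [A HA], (H2 (e / 2) ltac:(lra)) as [B HB].
  set (T := Rmax A B). specialize (HA T (Rmax_l _ _)). specialize (HB T (Rmax_r _ _)).
  replace (l - m)%C with (- (F T - l) + (F T - m))%C by ring.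
  eapply Rle_trans; [apply Cmod_triangle|]. rewrite Cmod_opp. lra.
Qed.

Lemma tends_le (F : R -> C) (l : C) (B : R) :
  tends F l -> (exists A, forall T, A <= T -> Cmod (F T) <= B) -> Cmod l <= B.
Proof.
  intros H [A HA]. apply le_epsilon. intros e He. destruct (H e He) as [A' HA'].
  set (T := Rmax A A'). specialize (HA T (Rmax_l _ _)). specialize (HA' T (Rmax_r _ _)).
  replace l with (F T + - (F T - l))%C by ring.
  eapply Rle_trans; [apply Cmod_triangle|]. rewrite Cmod_opp. lra.
Qed.

Lemma tends_inv (F : R -> C) (l : C) (K : R) :
  (forall T, 1 <= T -> Cmod (F T - l)%C <= K / T) -> tends F l.
Proof.
  intros H e He. exists (Rmax 1 (K / e)). intros T HT.
  assert (1 <= T) by (eapply Rle_trans; [apply Rmax_l|exact HT]).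
  assert (K / e <= T) by (eapply Rle_trans; [apply Rmax_r|exact HT]).
  eapply Rle_trans; [now apply H|]. apply (Rmult_le_reg_r T); [lra|].
  replace (K / T * T) with (K / e * e) by (field; lra). nra.
Qed.

Lemma Rpower_vanish (k e : R) : 0 < k -> 0 < e ->
  exists A, 0 <= A /\ forall x, A <= x -> Rpower (1 + x) (- k) <= e.
Proof.
  intros Hk He. exists (exp (Rabs (ln e) / k)).
  assert (Hp := exp_pos (Rabs (ln e) / k)). split; [lra|]. intros x Hx.
  rewrite <- (exp_ln e) by exact He. unfold Rpower.
  assert (H : Rabs (ln e) / k <= ln (1 + x)).
  { rewrite <- (ln_exp (Rabs (ln e) / k)). apply ln_le; lra. }
  assert (H' : Rabs (ln e) <= k * ln (1 + x)).
  { apply (Rmult_le_compat_l k) in H; [|lra]. replace (k * (Rabs (ln e) / k)) with (Rabs (ln e)) in H by (field; lra). exact H. }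
  assert (G : - k * ln (1 + x) <= ln e).
  { generalize (Rle_abs (- ln e)). rewrite Rabs_Ropp. lra. }
  destruct G as [G|G]; [left; now apply exp_increasing|right; now rewrite G].
Qed.

(** * Integrals of functions with polynomial decay *)

Definition decay_rate (tau y : R) : R := Rpower (1 + Rabs y) (- tau).

(** For tau > 1 and A >= 0 this is the integral of [decay_rate tau] from A to infinity. *)
Definition decay_tail (tau A : R) : R := Rpower (1 + A) (- (tau - 1)) / (tau - 1).

Lemma is_RInt_decay_rate (tau s t : R) : 1 < tau -> 0 <= s <= t ->
  is_RInt (decay_rate tau) s t (decay_tail tau s - decay_tail tau t).
Proof.
  intros Htau Hst.
  replace (decay_tail tau s - decay_tail tau t) with (minus (- decay_tail tau t) (- decay_tail tau s))
    by (unfold minus, plus, opp; simpl; ring).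
  apply (is_RInt_ext (fun y => Rpower (1 + y) (- tau))).
  { intros y Hy. rewrite Rmin_left, Rmax_right in Hy by lra. unfold decay_rate. now rewrite Rabs_pos_eq by lra. }
  apply (is_RInt_derive (V := R_CompleteNormedModule) (fun y => - decay_tail tau y)); rewrite Rmin_left, Rmax_right by lra.
  - intros y Hy. unfold decay_tail, Rpower. auto_derive; [lra|].
    replace (- tau * ln (1 + y)) with (- (tau - 1) * ln (1 + y) + - ln (1 + y)) by ring.
    rewrite exp_plus, exp_Ropp, exp_ln by lra. field. lra.
  - intros y Hy. apply (ex_derive_continuous (K := R_AbsRing) (V := R_NormedModule)).
    unfold Rpower. auto_derive. lra.
Qed.

Lemma is_RInt_decay_rate_neg (tau s t : R) : 1 < tau -> s <= t <= 0 ->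
  is_RInt (decay_rate tau) s t (decay_tail tau (- t) - decay_tail tau (- s)).
Proof.
  intros Htau Hst. assert (H := is_RInt_decay_rate tau (- t) (- s) Htau ltac:(lra)).
  apply is_RInt_swap in H. apply is_RInt_comp_opp in H. apply is_RInt_opp in H.
  rewrite opp_opp in H. revert H. apply is_RInt_ext. intros y _.
  rewrite opp_opp. unfold decay_rate. now rewrite Rabs_Ropp.
Qed.

Lemma decay_tail_pos (tau A : R) : 1 < tau -> 0 < decay_tail tau A.
Proof. intros H. apply Rdiv_lt_0_compat; [apply exp_pos|lra]. Qed.

Lemma ball_Cmod (z w : C) (e : R) : Cmod (w - z)%C < e -> ball (M := C_R_CompleteNormedModule) z e w.
Proof.
  intros H. split.
  - change (Rabs (Re w - Re z) < e). eapply Rle_lt_trans; [|exact H].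
    apply (Rabs_Re_le_Cmod (w - z)%C).
  - change (Rabs (Im w - Im z) < e). eapply Rle_lt_trans; [|exact H].
    apply (Rabs_Im_le_Cmod (w - z)%C).
Qed.

Lemma Cmod_ball (z w : C) (e : R) : ball (M := C_R_CompleteNormedModule) z e w -> Cmod (w - z)%C <= 2 * e.
Proof.
  intros [H1 H2]. change (Rabs (Re w - Re z) < e) in H1. change (Rabs (Im w - Im z) < e) in H2.
  eapply Rle_trans; [apply Cmod_le_Rabs|].
  change (Rabs (Re w - Re z) + Rabs (Im w - Im z) <= 2 * e). lra.
Qed.

Section Decay.
Variables (g : R -> C) (K tau : R).
Hypothesis Htau : 1 < tau.
Hypothesis HK : 0 <= K.
Hypothesis Hcont : forall y, continuous_C g y.
Hypothesis Hdecay : forall y, Cmod (g y) <= K * decay_rate tau y.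

Let Hex (a b : R) : ex_Cint g a b.
Proof. apply ex_Cint_continuous. auto. Qed.

Let Hpos (s t : R) : 0 <= s <= t -> Cmod (Cint g s t) <= 2 * (K * decay_tail tau s).
Proof.
  intros Hst. assert (H := is_RInt_scal _ _ _ K _ (is_RInt_decay_rate tau s t Htau Hst)).
  eapply Rle_trans.
  - apply (Cmod_Cint_le g (fun y => scal K (decay_rate tau y)) s t); [lra|apply Hex|eexists; exact H|].
    intros y _. apply Hdecay.
  - apply Rmult_le_compat_l; [lra|].
    apply (Rle_trans _ (K * (decay_tail tau s - decay_tail tau t))).
    + right. apply is_RInt_unique. exact H.
    + generalize (decay_tail_pos tau t Htau). nra.
Qed.

Let Hneg (s t : R) : s <= t <= 0 -> Cmod (Cint g s t) <= 2 * (K * decay_tail tau (- t)).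
Proof.
  intros Hst. assert (H := is_RInt_scal _ _ _ K _ (is_RInt_decay_rate_neg tau s t Htau Hst)).
  eapply Rle_trans.
  - apply (Cmod_Cint_le g (fun y => scal K (decay_rate tau y)) s t); [lra|apply Hex|eexists; exact H|].
    intros y _. apply Hdecay.
  - apply Rmult_le_compat_l; [lra|].
    apply (Rle_trans _ (K * (decay_tail tau (- t) - decay_tail tau (- s)))).
    + right. apply is_RInt_unique. exact H.
    + generalize (decay_tail_pos tau (- s) Htau). nra.
Qed.

Lemma Cmod_Cint_decay (T : R) : 0 <= T -> Cmod (Cint g (- T) T) <= 4 * (K * decay_tail tau 0).
Proof.
  intros HT. rewrite <- (Cint_Chasles g (- T) 0 T) by apply Hex.
  eapply Rle_trans; [apply Cmod_triangle|].
  generalize (Hpos 0 T ltac:(lra)), (Hneg (- T) 0 ltac:(lra)). rewrite Ropp_0. lra.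
Qed.

Lemma Cint_decay_Cauchy (A s t : R) : 0 <= A -> s <= - A -> A <= t ->
  Cmod (Cint g s t - Cint g (- A) A)%C <= 4 * (K * decay_tail tau A).
Proof.
  intros HA Hs Ht.
  rewrite <- (Cint_Chasles g s (- A) t), <- (Cint_Chasles g (- A) A t) by apply Hex.
  replace (Cint g s (- A) + (Cint g (- A) A + Cint g A t) - Cint g (- A) A)%C
    with (Cint g s (- A) + Cint g A t)%C by ring.
  eapply Rle_trans; [apply Cmod_triangle|].
  generalize (Hpos A t ltac:(lra)), (Hneg s (- A) ltac:(lra)). rewrite Ropp_involutive. lra.
Qed.

Lemma decay_tail_small (e : R) : 0 < e -> exists A, 0 <= A /\ forall x, A <= x -> 4 * (K * decay_tail tau x) <= e.
Proof.
  intros He. set (k := 4 * (K + 1) / (tau - 1)).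
  assert (Hk : 0 < k) by (apply Rdiv_lt_0_compat; lra).
  destruct (Rpower_vanish (tau - 1) (e / k) ltac:(lra) ltac:(now apply Rdiv_lt_0_compat)) as [A [HA0 HA]].
  exists A. split; [exact HA0|]. intros x Hx. specialize (HA x Hx).
  apply (Rle_trans _ (k * (e / k))); [|right; field; lra].
  apply (Rle_trans _ (k * Rpower (1 + x) (- (tau - 1)))); [|apply Rmult_le_compat_l; lra].
  unfold decay_tail, k. assert (0 < Rpower (1 + x) (- (tau - 1)) / (tau - 1)) by now apply (decay_tail_pos tau x).
  replace (4 * (K + 1) / (tau - 1) * Rpower (1 + x) (- (tau - 1))) with (4 * ((K + 1) * (Rpower (1 + x) (- (tau - 1)) / (tau - 1)))) by (field; lra).
  nra.
Qed.

(** The Cauchy criterion on the product filter gives a limit over independent end points, and the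
    symmetric truncations have the same limit. This is the link between [RInt_gen] and the values
    computed on [-T, T]. *)
Lemma is_RInt_gen_decay : exists l : C,
  is_RInt_gen (V := C_R_NormedModule) g (Rbar_locally m_infty) (Rbar_locally p_infty) l /\
  tends (fun T => Cint g (- T) T) l.
Proof.
  set (F := filter_prod (Rbar_locally m_infty) (Rbar_locally p_infty)).
  assert (FP : forall A, F (fun ab => fst ab <= - A /\ A <= snd ab)).
  { intros A. apply (Filter_prod _ _ _ (fun s => s < - A) (fun t => A < t)).
    - now exists (- A).
    - now exists A.
    - intros s t H1 H2. simpl. lra. }
  destruct (proj1 (filterlim_locally_cauchy (U := C_R_CompleteNormedModule) (F := F)
    (fun ab => Cint g (fst ab) (snd ab)))) as [l Hl].
  - intros eps. destruct (decay_tail_small (eps / 4)) as [A [HA0 HA]]; [generalize (cond_pos eps); lra|].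
    exists (fun ab => fst ab <= - A /\ A <= snd ab). split; [apply FP|].
    intros [s t] [s' t'] [H1 H2] [H3 H4]; simpl in *. apply ball_Cmod.
    replace (Cint g s' t' - Cint g s t)%C with
      ((Cint g s' t' - Cint g (- A) A) + - (Cint g s t - Cint g (- A) A))%C by ring.
    eapply Rle_lt_trans; [apply Cmod_triangle|]. rewrite Cmod_opp.
    generalize (Cint_decay_Cauchy A s t HA0 H1 H2), (Cint_decay_Cauchy A s' t' HA0 H3 H4), (HA A (Rle_refl _)), (cond_pos eps). lra.
  - exists l. split.
    + intros P HP. specialize (Hl P HP). unfold filtermapi. unfold filtermap in Hl.
      revert Hl. apply filter_imp. intros [s t] H; simpl in *.
      exists (Cint g s t). split; [apply is_RInt_Cint, Hex|exact H].
    + intros e He. assert (He2 : 0 < e / 2) by lra.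
      assert (B : F (fun ab => ball (M := C_R_CompleteNormedModule) l (mkposreal _ He2) (Cint g (fst ab) (snd ab)))).
      { apply (proj1 (filterlim_locally _ _) Hl). }
      destruct B as [P Q [a Ha] [b Hb] HPQ]. exists (Rmax (1 - a) (1 + b)). intros T HT.
      assert (1 - a <= T) by (eapply Rle_trans; [apply Rmax_l|exact HT]).
      assert (1 + b <= T) by (eapply Rle_trans; [apply Rmax_r|exact HT]).
      specialize (HPQ (- T) T (Ha (- T) ltac:(lra)) (Hb T ltac:(lra))). simpl in HPQ.
      apply Cmod_ball in HPQ. lra.
Qed.

End Decay.

(** |z|^(-Re a) is split into |z|^(-kappa) <= c^(-kappa), which improves as the line moves right,
    and |z|^(-tau), which decays in y. The latter uses |z| >= (c + |y|) / 2 >= (min(c, 1) / 2) (1 +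
    |y|). *)
Lemma Cmod_Cpower_decay (a : C) (c kappa tau y : R) :
  0 < c -> 0 <= kappa -> 0 <= tau -> kappa + tau = Re a ->
  Cmod (Cpower (c, y) (- a)%C) <=
  power_const a * Rpower c (- kappa) * Rpower (Rmin c 1 / 2) (- tau) * decay_rate tau y.
Proof.
  intros Hc Hk Ht E. eapply Rle_trans; [now apply Cmod_Cpower_neg_le|].
  rewrite !Rmult_assoc. apply Rmult_le_compat_l; [left; apply exp_pos|].
  assert (M1 := Rmin_l c 1). assert (M2 := Rmin_r c 1). assert (M3 : 0 < Rmin c 1) by (apply Rmin_glb_lt; lra).
  assert (H1 : c <= Cmod (c, y)).
  { eapply Rle_trans; [|apply Rabs_Re_le_Cmod]. apply Rle_abs. }
  assert (H2 := Rabs_Im_le_Cmod (c, y)). simpl in H2. assert (Hy := Rabs_pos y).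
  replace (- Re a) with (- kappa + - tau) by lra. rewrite Rpower_plus.
  apply Rmult_le_compat; try (left; apply exp_pos).
  - apply Rpower_neg_le; [exact Hk|]. lra.
  - unfold decay_rate. rewrite Rpower_mult_distr by lra.
    apply Rpower_neg_le; [exact Ht|]. split; [apply Rmult_lt_0_compat; lra|]. nra.
Qed.

(** * Shifting the line to infinity *)

Lemma Ccot_affine_shift (n : nat) (p x y : R) :
  Ccot (PI * ((x + INR n, y)%R - p))%C = Ccot (PI * ((x, y) - p))%C.
Proof.
  rewrite <- (Ccot_plus_natPI n (PI * ((x, y) - p))). f_equal. apply C_ext; simpl; ring.
Qed.

(** The pole matters only modulo 1, so [cot_power_shift] applies to one and the same function at
    each of p, p + 1, p + 2 and so on. *)
Lemma cot_power_pole_shift (n : nat) (a : C) (p : R) (z : C) :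
  cot_power a (p + INR n) z = cot_power a p z.
Proof.
  unfold cot_power. f_equal. rewrite <- (Ccot_plus_natPI n (PI * (z - (p + INR n)%R))). f_equal.
  rewrite RtoC_plus. ring.
Qed.

Lemma sin_PI_neq0 (e p : R) : -1 < e - p < 1 -> e <> p -> sin (PI * (e - p)) <> 0.
Proof.
  intros H Hne E. apply sin_eq_0_0 in E. destruct E as [j E].
  assert (Hj : e - p = IZR j) by (apply (Rmult_eq_reg_l PI); generalize PI_RGT_0; lra).
  assert (IZR j = 0) by (apply IZR_between_1; lra). lra.
Qed.

Lemma Cmod_Ccot_affine_le (p x y : R) : sin (PI * (x - p)) <> 0 ->
  Cmod (Ccot (PI * ((x, y) - p))%C) <= / Rabs (sin (PI * (x - p))).
Proof.
  intros H. replace (PI * ((x, y) - p))%C with (PI * (x - p), PI * y) by (apply C_ext; simpl; ring).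
  now apply Cmod_Ccot_le.
Qed.

Lemma Csin_affine_neq0 (p x y : R) : sin (PI * (x - p)) <> 0 -> Csin (PI * ((x, y) - p))%C <> 0%C.
Proof.
  intros H. replace (PI * ((x, y) - p))%C with (PI * (x - p), PI * y) by (apply C_ext; simpl; ring).
  apply Csin_neq0. now left.
Qed.

Lemma sin_PI_shift (n : nat) (p x : R) : sin (PI * (x - p)) <> 0 -> sin (PI * (x + INR n - p)) <> 0.
Proof.
  intros H. induction n as [|n IH].
  - rewrite INR_0. now replace (x + 0 - p) with (x - p) by ring.
  - rewrite S_INR. replace (PI * (x + (INR n + 1) - p)) with (PI * (x + INR n - p) + PI) by ring.
    rewrite neg_sin. lra.
Qed.

(** By periodicity of the cotangent, and since min(e, 1) <= min(e + n, 1), the constants of the line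
    Re z = e serve for all n. Only the factor (e + n)^(-kappa) depends on n. *)
Lemma cot_power_decay (a : C) (p e kappa tau : R) (n : nat) (y : R) :
  0 < e -> sin (PI * (e - p)) <> 0 -> 0 <= kappa -> 0 <= tau -> kappa + tau = Re a ->
  Cmod (cot_power a p (e + INR n, y)%R) <=
  / Rabs (sin (PI * (e - p))) * power_const a * Rpower (e + INR n) (- kappa) * Rpower (Rmin e 1 / 2) (- tau) * decay_rate tau y.
Proof.
  intros He Hs Hk Ht E. unfold cot_power. rewrite Cmod_mult, Ccot_affine_shift, !Rmult_assoc.
  apply Rmult_le_compat; try apply Cmod_ge_0; [now apply Cmod_Ccot_affine_le|].
  assert (Hn := pos_INR n). assert (Hm := exp_pos (- tau * ln (1 + Rabs y))).
  eapply Rle_trans; [apply (Cmod_Cpower_decay a (e + INR n) kappa tau); auto; lra|].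
  rewrite !Rmult_assoc. apply Rmult_le_compat_l; [left; apply exp_pos|].
  apply Rmult_le_compat_l; [left; apply exp_pos|].
  apply Rmult_le_compat_r; [left; apply Hm|].
  apply Rpower_neg_le; [exact Ht|].
  assert (0 < Rmin e 1) by (apply Rmin_glb_lt; lra).
  assert (Rmin e 1 <= Rmin (e + INR n) 1).
  { apply Rmin_glb; [|apply Rmin_r]. eapply Rle_trans; [apply Rmin_l|lra]. }
  lra.
Qed.

(** The unit shifts telescope; the n-th one crosses only p + n because e < p < e + 1. *)
Lemma cot_power_partial_sum (a : C) (p e : R) (N : nat) :
  1 <= Re a -> 0 < e -> e < p < e + 1 ->
  tends (fun T => Cint (fun y => cot_power a p (e + INR (S N), y)%R) (- T) T
                  - Cint (fun y => cot_power a p (e, y)) (- T) T)%C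
        (2 * Csum (fun n => Cpower (INR n + p) (- a)) 0 N)%C.
Proof.
  intros Ha He Hp.
  assert (Step : forall n, tends (fun T => Cint (fun y => cot_power a p (e + INR (S n), y)%R) (- T) T
                  - Cint (fun y => cot_power a p (e + INR n, y)%R) (- T) T)%C (2 * Cpower (INR n + p) (- a))%C).
  { intros n. assert (Hn := pos_INR n).
    destruct (cot_power_shift a (e + INR n) (p + INR n) Ha ltac:(lra) ltac:(lra)) as [K HK].
    apply (tends_inv _ _ K). intros T HT. specialize (HK T HT).
    rewrite (Cint_ext _ (fun y => cot_power a p (e + INR (S n), y)%R)) in HK.
    2:{ intros y. rewrite cot_power_pole_shift, S_INR. f_equal. f_equal. ring. }
    rewrite (Cint_ext (fun y => cot_power a (p + INR n) (e + INR n, y)%R) (fun y => cot_power a p (e + INR n, y)%R)) in HK.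
    2:{ intros y. now rewrite cot_power_pole_shift. }
    replace (INR n + p)%C with (RtoC (p + INR n)) by (rewrite RtoC_plus; ring). exact HK. }
  induction N as [|N IH].
  - rewrite Csum_one. generalize (Step 0%nat). apply tends_ext. intros T.
    rewrite (Cint_ext (fun y => cot_power a p (e + INR 0, y)%R) (fun y => cot_power a p (e, y))); [reflexivity|].
    intros y. rewrite INR_0. f_equal. f_equal. ring.
  - rewrite Csum_last, Cmult_plus_distr_l. generalize (tends_plus _ _ _ _ IH (Step (S N))).
    apply tends_ext. intros T. ring.
Qed.

Lemma Re_Csum (u : nat -> C) (n : nat) :
  Re (Csum u 0 n) = sum_n (fun k => Re (u k)) n /\ Im (Csum u 0 n) = sum_n (fun k => Im (u k)) n.
Proof.
  induction n as [|n [IH1 IH2]].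
  - rewrite Csum_one, !sum_O. now split.
  - rewrite Csum_last, !sum_Sn, <- IH1, <- IH2. now split.
Qed.

Lemma CSeries_unique (u : nat -> C) (l : C) :
  (forall e, 0 < e -> exists N, forall n, (N <= n)%nat -> Cmod (Csum u 0 n - l)%C <= e) ->
  CSeries u = l.
Proof.
  intros H. unfold CSeries. apply C_ext; apply is_series_unique.
  - apply filterlim_locally. intros eps. assert (Heps := cond_pos eps).
    destruct (H (eps / 2) ltac:(lra)) as [N HN]. exists N. intros n Hn. specialize (HN n Hn).
    change (Rabs (sum_n (fun k => Re (u k)) n - Re l) < eps).
    rewrite <- (proj1 (Re_Csum u n)). eapply Rle_lt_trans; [apply (Rabs_Re_le_Cmod (Csum u 0 n - l)%C)|]. lra.
  - apply filterlim_locally. intros eps. assert (Heps := cond_pos eps).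
    destruct (H (eps / 2) ltac:(lra)) as [N HN]. exists N. intros n Hn. specialize (HN n Hn).
    change (Rabs (sum_n (fun k => Im (u k)) n - Im l) < eps).
    rewrite <- (proj2 (Re_Csum u n)). eapply Rle_lt_trans; [apply (Rabs_Im_le_Cmod (Csum u 0 n - l)%C)|]. lra.
Qed.

(* The residues of [cot (pi (z - p)) z^(-a)] at [p + n] add up to the Hurwitz zeta function. *)
Lemma cot_power_integral (a : C) (p e : R) :
  1 < Re a -> 0 < e -> e < p < e + 1 ->
  tends (fun T => Cint (fun y => cot_power a p (e, y)) (- T) T) (- 2 * hurwitz_zeta a p)%C.
Proof.
  intros Ha He Hp.
  assert (Hs : sin (PI * (e - p)) <> 0) by (apply sin_PI_neq0; lra).
  (* Halving the excess of Re a over 1 gives kappa > 0 for the limit in n and tau > 1 for the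
     integrability in y. *)
  set (kappa := (Re a - 1) / 2). set (tau := (Re a + 1) / 2).
  assert (Hkt : kappa + tau = Re a) by (unfold kappa, tau; lra).
  assert (Hk : 0 < kappa) by (unfold kappa; lra). assert (Ht : 1 < tau) by (unfold tau; lra).
  set (B := / Rabs (sin (PI * (e - p))) * power_const a).
  set (R0 := Rpower (Rmin e 1 / 2) (- tau)).
  assert (HB : 0 < B).
  { apply Rmult_lt_0_compat; [now apply Rinv_0_lt_compat, Rabs_pos_lt|apply exp_pos]. }
  assert (HR0 : 0 < R0) by apply exp_pos.
  assert (Hcont : forall n y, continuous_C (fun v => cot_power a p (e + INR n, v)%R) y).
  { intros n y. apply ccontinuous_vertical, ccontinuous_cot_power.
    - generalize (pos_INR n); lra.
    - apply Csin_affine_neq0, sin_PI_shift, Hs. }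
  assert (Hdec := fun n y => cot_power_decay a p e kappa tau n y He Hs (Rlt_le _ _ Hk) ltac:(lra) Hkt).
  fold B R0 in Hdec.
  assert (HKn : forall n, 0 <= B * Rpower (e + INR n) (- kappa) * R0).
  { intros n. apply Rmult_le_pos; [|lra]. apply Rmult_le_pos; [lra|left; apply exp_pos]. }
  assert (E0 : forall y, cot_power a p (e + INR 0, y)%R = cot_power a p (e, y)).
  { intros y. f_equal. f_equal. rewrite INR_0. ring. }
  destruct (is_RInt_gen_decay _ _ tau Ht (HKn 0%nat) (Hcont 0%nat) (Hdec 0%nat)) as [l [_ Hl]].
  apply (tends_ext _ (fun T => Cint (fun y => cot_power a p (e, y)) (- T) T)) in Hl.
  2:{ intros T. now apply Cint_ext. }
  (* The left side is the modulus of the integral over Re z = e + N + 1, which the decay estimate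
     makes small; hence the partial sums converge to -l / 2. *)
  assert (Hbound : forall N, Cmod (2 * Csum (fun n => Cpower (INR n + p) (- a)) 0 N + l)%C
     <= 4 * (B * Rpower (e + INR (S N)) (- kappa) * R0 * decay_tail tau 0)).
  { intros N. apply (tends_le (fun T => Cint (fun y => cot_power a p (e + INR (S N), y)%R) (- T) T)).
    - generalize (tends_plus _ _ _ _ (cot_power_partial_sum a p e N ltac:(lra) He Hp) Hl).
      apply tends_ext. intros T. ring.
    - exists 0. intros T HT. apply (Cmod_Cint_decay _ _ tau Ht (HKn (S N)) (Hcont (S N)) (Hdec (S N)) T HT). }
  replace (- 2 * hurwitz_zeta a p)%C with l; [exact Hl|].
  unfold hurwitz_zeta. destruct (Rlt_dec 1 (Re a)) as [_|n]; [|contradiction].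
  unfold hurwitz_series. rewrite (CSeries_unique _ (- / 2 * l)%C); [field|].
  intros eps Heps.
  (* Half of the constant 4 in [Hbound], since the distance to the limit is half the quantity
     bounded there. *)
  set (D := 2 * (B * R0 * decay_tail tau 0)).
  assert (HD : 0 < D).
  { apply Rmult_lt_0_compat; [lra|].
    apply Rmult_lt_0_compat; [now apply Rmult_lt_0_compat|now apply decay_tail_pos]. }
  destruct (Rpower_vanish kappa (eps / D) Hk ltac:(now apply Rdiv_lt_0_compat)) as [A [HA0 HA]].
  destruct (INR_unbounded A) as [N HN]. exists N. intros n Hn.
  assert (HNn : INR N <= INR n) by now apply le_INR.
  set (Sn := Csum (fun n0 => Cpower (INR n0 + p)%C (- a)%C) 0 n).
  specialize (Hbound n). fold Sn in Hbound. rewrite S_INR in Hbound.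
  replace (Sn - - / 2 * l)%C with (/ 2 * (2 * Sn + l))%C by field.
  rewrite Cmod_mult, <- RtoC_inv, Cmod_R, Rabs_pos_eq by lra.
  replace (e + (INR n + 1)) with (1 + (INR n + e)) in Hbound by ring.
  specialize (HA (INR n + e) ltac:(lra)).
  apply (Rle_trans _ (D * (eps / D))); [|right; field; lra].
  apply (Rle_trans _ (D * Rpower (1 + (INR n + e)) (- kappa))); [|apply Rmult_le_compat_l; lra].
  unfold D. lra.
Qed.

(** * The integral of the product of cotangents *)

(** Integrability on each segment is part of the notion because [Cint] is additive only on
    integrable functions. A symmetric limit suffices for the separate terms, as the improper
    integral of the whole is known to exist. *)
Definition has_symmetric_integral (g : R -> C) (l : C) : Prop :=
  (forall T, ex_Cint g (- T) T) /\ tends (fun T => Cint g (- T) T) l.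

Lemma has_symmetric_integral_ext (f g : R -> C) (l : C) :
  (forall y, f y = g y) -> has_symmetric_integral f l -> has_symmetric_integral g l.
Proof.
  intros E [H1 H2]. split.
  - intros T. destruct (H1 T) as [A B]. split; [eapply ex_RInt_ext; [|exact A]|eapply ex_RInt_ext; [|exact B]];
    intros y _; simpl; now rewrite E.
  - revert H2. apply tends_ext. intros T. now apply Cint_ext.
Qed.

Lemma has_symmetric_integral_plus (f g : R -> C) (l m : C) :
  has_symmetric_integral f l -> has_symmetric_integral g m ->
  has_symmetric_integral (fun y => f y + g y)%C (l + m)%C.
Proof.
  intros [F1 F2] [G1 G2]. split.
  - intros T. now apply ex_Cint_plus.
  - generalize (tends_plus _ _ _ _ F2 G2). apply tends_ext. intros T. symmetry. now apply Cint_plus.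
Qed.

Lemma has_symmetric_integral_scal (c : C) (f : R -> C) (l : C) :
  has_symmetric_integral f l -> has_symmetric_integral (fun y => c * f y)%C (c * l)%C.
Proof.
  intros [F1 F2]. split.
  - intros T. now apply ex_Cint_scal.
  - generalize (tends_scal c _ _ F2). apply tends_ext. intros T. symmetry. now apply Cint_scal.
Qed.

Lemma has_symmetric_integral_Csum (f : nat -> R -> C) (l : nat -> C) (n : nat) :
  (forall m, (1 <= m <= n)%nat -> has_symmetric_integral (f m) (l m)) ->
  has_symmetric_integral (fun y => Csum (fun m => f m y) 1 n) (Csum l 1 n).
Proof.
  intros H. induction n as [|n IH].
  - apply (has_symmetric_integral_ext (fun _ => 0%C)).
    { intros y. symmetry. apply Csum_zero. lia. }
    rewrite (Csum_zero l) by lia. split.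
    + intros T. split; apply ex_RInt_const.
    + apply (tends_ext (fun _ => 0%C)); [|apply tends_const].
      intros T. unfold Cint. simpl. rewrite RInt_const.
      apply C_ext; symmetry; exact (Rmult_0_r _).
  - assert (E : forall u : nat -> C, Csum u 1 (S n) = (Csum u 1 n + u (S n))%C).
    { intros u. exact (sum_n_Sm (G := C_AbelianMonoid) u 1 n ltac:(lia)). }
    rewrite E. apply (has_symmetric_integral_ext (fun y => Csum (fun m => f m y) 1 n + f (S n) y)%C).
    { intros y. now rewrite E. }
    apply has_symmetric_integral_plus; [apply IH; intros m Hm|]; apply H; lia.
Qed.

(** Up to the factor -i the integral over [-T, T] is F(e, T) - F(e, -T), and both end values tend to
    0. Any tau > 0 will do, since F itself need not be integrable. *)
Lemma has_symmetric_integral_derive (F dF : C -> C) (e K tau : R) :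
  0 < tau -> 0 <= K ->
  (forall y, is_C1 F dF (e, y)) ->
  (forall y, Cmod (F (e, y)) <= K * decay_rate tau y) ->
  has_symmetric_integral (fun y => dF (e, y)) 0.
Proof.
  intros Ht HK HC1 HF.
  apply (has_symmetric_integral_ext (fun y => - Ci * (Ci * dF (e, y)))%C).
  { intros y. transitivity (- (Ci * Ci) * dF (e, y))%C; [ring|]. rewrite Ci_sqr. ring. }
  replace (RtoC 0) with (- Ci * 0)%C by ring. apply has_symmetric_integral_scal. split.
  - intros T. apply ex_Cint_scal, ex_Cint_ccontinuous. intros y. apply HC1.
  - apply (tends_ext (fun T => F (e, T) - F (e, - T)%R)%C).
    { intros T. symmetry. apply (Cint_derive F dF). intros y _. split; apply HC1. }
    intros eps Heps.
    destruct (Rpower_vanish tau (eps / (2 * (K + 1))) Ht ltac:(apply Rdiv_lt_0_compat; lra)) as [A [HA0 HA]].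
    exists A. intros T HT. specialize (HA T HT).
    assert (B1 := HF T). assert (B2 := HF (- T)). unfold decay_rate in *.
    rewrite Rabs_Ropp in B2. rewrite Rabs_pos_eq in B1, B2 by lra.
    replace (F (e, T) - F (e, - T)%R - 0)%C with (F (e, T) + - F (e, - T)%R)%C by ring.
    eapply Rle_trans; [apply Cmod_triangle|]. rewrite Cmod_opp.
    apply (Rle_trans _ (2 * (K + 1) * (eps / (2 * (K + 1))))); [|right; field; lra].
    assert (0 < Rpower (1 + T) (- tau)) by apply exp_pos. nra.
Qed.

(** The primitive z^(1-a) / (1 - a) vanishes at both ends because Re a > 1. *)
Lemma Cpower_integral (a : C) (e : R) : 1 < Re a -> 0 < e ->
  has_symmetric_integral (fun y => Cpower (e, y) (- a)%C) 0.
Proof.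
  intros Ha He.
  assert (H1 : (1 - a)%C <> 0%C).
  { intros E. apply (f_equal Re) in E. change (1 + - Re a = 0) in E. lra. }
  apply (has_symmetric_integral_ext (fun y => / (1 - a) * ((1 - a) * Cpower (e, y) (1 - a - 1)))%C).
  { intros y. replace (1 - a - 1)%C with (- a)%C by ring. field. exact H1. }
  replace (RtoC 0) with (/ (1 - a) * 0)%C by ring. apply has_symmetric_integral_scal.
  apply (has_symmetric_integral_derive (fun z => Cpower z (1 - a))%C (fun z => (1 - a) * Cpower z (1 - a - 1))%C e
    (power_const (a - 1)%C * Rpower e (- 0) * Rpower (Rmin e 1 / 2) (- (Re a - 1))) (Re a - 1)); [lra| | |].
  - apply Rmult_le_pos; [apply Rmult_le_pos|]; left; apply exp_pos.
  - intros y. split; [now apply is_cderive_Cpower|].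
    apply ccontinuous_mult; [apply ccontinuous_const|now apply ccontinuous_Cpower].
  - intros y. replace (1 - a)%C with (- (a - 1))%C by ring.
    apply (Cmod_Cpower_decay (a - 1)%C e 0 (Re a - 1) y He); try lra.
    change (0 + (Re a - 1) = Re a + - 1). lra.
Qed.

Lemma cot_power_has_integral (a : C) (p e : R) : 1 < Re a -> 0 < e -> e < p < e + 1 ->
  has_symmetric_integral (fun y => cot_power a p (e, y)) (- 2 * hurwitz_zeta a p)%C.
Proof.
  intros Ha He Hp. split; [|now apply cot_power_integral].
  intros T. apply ex_Cint_ccontinuous. intros y. apply ccontinuous_cot_power; [exact He|].
  apply Csin_affine_neq0, sin_PI_neq0; lra.
Qed.

Lemma csc_power_integral (a : C) (e : R) : 1 < Re a -> 0 < e < 1 ->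
  has_symmetric_integral
    (fun y => / (Csin (PI * (e, y)) * Csin (PI * (e, y))) * Cpower (e, y) (- a))%C
    (2 * a * zeta (a + 1) / PI)%C.
Proof.
  intros Ha He.
  assert (HPI : RtoC PI <> 0%C) by (apply RtoC_neq, PI_neq0).
  assert (Hs : sin (PI * (e - 0)) <> 0) by (apply sin_PI_neq0; lra).
  set (dF := fun z => (- PI * / (Csin (PI * (z - 0)) * Csin (PI * (z - 0))) * Cpower z (- a)
     + Ccot (PI * (z - 0)) * (- a * Cpower z (- a - 1)))%C).
  (* [dF] is the derivative of cot(pi z) z^(-a), so its integral is 0. In the remaining cotangent
     the pole 0, which lies left of the line, is replaced by the pole 1 in (e, e + 1); this is why
     zeta(a + 1, 1) appears. *)
  apply (has_symmetric_integral_ext (fun y => - / PI * (dF (e, y) + a * cot_power (a + 1) 1 (e, y)))%C).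
  { intros y. unfold dF, cot_power. replace (- (a + 1))%C with (- a - 1)%C by ring.
    rewrite <- (Ccot_plus_PI (PI * ((e, y) - 1))).
    replace (PI * ((e, y) - 1) + PI)%C with (PI * (e, y))%C by ring.
    replace ((e, y) - 0)%C with ((e, y) : C) by (apply C_ext; simpl; ring).
    field. split; [|exact HPI].
    replace (PI * (e, y))%C with (PI * ((e, y) - 0%R))%C by ring. now apply Csin_affine_neq0. }
  replace (2 * a * zeta (a + 1) / PI)%C with (- / PI * (0 + a * (- 2 * hurwitz_zeta (a + 1) 1)))%C
    by (unfold zeta; field; exact HPI).
  apply has_symmetric_integral_scal, has_symmetric_integral_plus.
  - apply (has_symmetric_integral_derive (cot_power a 0) dF e
      (/ Rabs (sin (PI * (e - 0))) * power_const a * Rpower (e + INR 0) (- 0) * Rpower (Rmin e 1 / 2) (- Re a)) (Re a)); [lra| | |].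
    + apply Rmult_le_pos; [|left; apply exp_pos]. apply Rmult_le_pos; [|left; apply exp_pos].
      apply Rmult_le_pos; [|left; apply exp_pos]. left. now apply Rinv_0_lt_compat, Rabs_pos_lt.
    + intros y. assert (Hsy := Csin_affine_neq0 0 e y Hs). split.
      * exact (is_cderive_mult _ _ _ _ _ (is_cderive_Ccot_affine 0 (e, y) Hsy) (is_cderive_Cpower (- a)%C (e, y) (proj1 He))).
      * unfold dF. apply ccontinuous_plus; apply ccontinuous_mult.
        -- apply ccontinuous_mult; [apply ccontinuous_const|].
           apply ccontinuous_Cinv; [now apply Cmult_neq_0|].
           apply ccontinuous_mult; apply ccontinuous_Csin, ccontinuous_affine.
        -- now apply ccontinuous_Cpower.
        -- apply ccontinuous_Ccot; [exact Hsy|apply ccontinuous_affine].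
        -- apply ccontinuous_mult; [apply ccontinuous_const|now apply ccontinuous_Cpower].
    + intros y. replace (e, y) with (e + INR 0, y) by (rewrite INR_0; f_equal; ring).
      apply cot_power_decay; auto; lra.
  - apply has_symmetric_integral_scal, cot_power_has_integral; try lra.
    change (1 < Re a + 1). lra.
Qed.

Lemma sin_PI_nat_neq0 (n : nat) (e : R) : 0 < e < 1 / INR (S n) -> sin (PI * (INR (S n) * e)) <> 0.
Proof.
  intros [H1 H2]. assert (Hn : 0 < INR (S n)) by (apply lt_0_INR; lia).
  assert (INR (S n) * e < 1).
  { apply (Rmult_lt_reg_l (/ INR (S n))); [now apply Rinv_0_lt_compat|].
    replace (/ INR (S n) * (INR (S n) * e)) with e by (field; lra). lra. }
  assert (0 < INR (S n) * e) by now apply Rmult_lt_0_compat.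
  assert (HPI := PI_RGT_0).
  apply Rgt_not_eq, sin_gt_0; nra.
Qed.

Lemma RInt_gen_unique_C (g : R -> C) (l : C) :
  is_RInt_gen (V := C_R_NormedModule) g (Rbar_locally m_infty) (Rbar_locally p_infty) l ->
  RInt_gen (V := C_R_CompleteNormedModule) g (Rbar_locally m_infty) (Rbar_locally p_infty) = l.
Proof. exact (is_RInt_gen_unique (V := C_R_CompleteNormedModule) g l). Qed.

Theorem theorem2 (a : C) (h k : nat) (eps : R)
    (ha : 1 < Re a) (hh : (0 < h)%nat) (hk : (0 < k)%nat)
    (hhk : Nat.gcd h k = 1%nat)
    (heps0 : 0 < eps) (heps : eps < Rmin (1 / INR h) (1 / INR k)) :
  let f (z : C) : C :=
    (Ccot (PI * INR h * z) * Ccot (PI * INR k * z) / Cpower z a)%C in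
  ex_vline_int f eps /\
  (Cpower (INR h) (1 - a) * bettin_conrey (- a) h k
   + Cpower (INR k) (1 - a) * bettin_conrey (- a) k h
   = a * zeta (a + 1) / (PI * Cpower (INR h * INR k)%R a)
     - Cpower (INR h * INR k)%R (1 - a) / (2 * Ci) * vline_int f eps)%C.
Proof.
  intros f. destruct h as [|p]; [lia|]. destruct k as [|n]; [lia|].
  assert (Hn : 0 < INR (S n)) by (apply lt_0_INR; lia).
  assert (Hp : 0 < INR (S p)) by (apply lt_0_INR; lia).
  assert (en : eps < 1 / INR (S n)) by (eapply Rlt_le_trans; [exact heps|apply Rmin_r]).
  assert (ep : eps < 1 / INR (S p)) by (eapply Rlt_le_trans; [exact heps|apply Rmin_l]).
  (* The upper bound on [eps] places each nonzero pole of the partial fractions in (eps, eps + 1),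
     as [cot_power_has_integral] requires. *)
  assert (Hfrac : forall q m, 0 < INR (S q) -> eps < 1 / INR (S q) -> (1 <= m <= q)%nat ->
     eps < INR m / INR (S q) < eps + 1).
  { intros q m Hq eq [Hm1 Hm2]. apply le_INR in Hm1. apply le_INR in Hm2. rewrite INR_1 in Hm1. split.
    - eapply Rlt_le_trans; [exact eq|]. unfold Rdiv. apply Rmult_le_compat_r; [|exact Hm1].
      left. now apply Rinv_0_lt_compat.
    - apply (Rmult_lt_reg_r (INR (S q))); [exact Hq|].
      replace (INR m / INR (S q) * INR (S q)) with (INR m) by (field; lra).
      rewrite S_INR in Hq |- *. nra. }
  assert (e1 : eps < 1).
  { eapply Rlt_le_trans; [exact en|].
    apply (Rmult_le_reg_r (INR (S n))); [exact Hn|]. replace (1 / INR (S n) * INR (S n)) with 1 by (field; lra).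
    rewrite S_INR. generalize (pos_INR n). lra. }
  assert (sn := sin_PI_nat_neq0 n eps (conj heps0 en)).
  assert (sp := sin_PI_nat_neq0 p eps (conj heps0 ep)).
  assert (HnC := RtoC_neq _ (Rgt_not_eq _ _ Hn)). assert (HpC := RtoC_neq _ (Rgt_not_eq _ _ Hp)).
  assert (HPI : RtoC PI <> 0%C) by (apply RtoC_neq, PI_neq0).
  assert (Harg : forall q y, (PI * INR (S q) * (eps, y))%C = (PI * (INR (S q) * eps), PI * INR (S q) * y)).
  { intros q y. apply C_ext; simpl; ring. }
  assert (Hzn : forall y, Csin (INR (S n) * (PI * (eps, y)))%C <> 0%C).
  { intros y. replace (INR (S n) * (PI * (eps, y)))%C with (PI * INR (S n) * (eps, y))%C by ring.
    rewrite Harg. apply Csin_neq0. now left. }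
  assert (Hzp : forall y, Csin (INR (S p) * (PI * (eps, y)))%C <> 0%C).
  { intros y. replace (INR (S p) * (PI * (eps, y)))%C with (PI * INR (S p) * (eps, y))%C by ring.
    rewrite Harg. apply Csin_neq0. now left. }
  set (Sn := Csum (fun m => Ccot (INR (S p) * root_arg n m)%R * (- 2 * hurwitz_zeta a (INR m / INR (S n))%R))%C 1 n).
  set (Sp := Csum (fun m => Ccot (INR (S n) * root_arg p m)%R * (- 2 * hurwitz_zeta a (INR m / INR (S p))%R))%C 1 p).
  assert (Hint : has_symmetric_integral (vline_integrand f eps)
    (Ci * ((- (1) * 0 + / INR (S n) * Sn) + (/ INR (S p) * Sp
     + / (INR (S n) * INR (S p)) * (2 * a * zeta (a + 1) / PI))))%C).
  { unfold vline_integrand. apply has_symmetric_integral_scal.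
    apply (has_symmetric_integral_ext (fun y =>
      (- (1) * Cpower (eps, y) (- a)
       + / INR (S n) * Csum (fun m => Ccot (INR (S p) * root_arg n m)%R * cot_power a (INR m / INR (S n)) (eps, y)) 1 n)
      + (/ INR (S p) * Csum (fun m => Ccot (INR (S n) * root_arg p m)%R * cot_power a (INR m / INR (S p)) (eps, y)) 1 p
      + / (INR (S n) * INR (S p)) * (/ (Csin (PI * (eps, y)) * Csin (PI * (eps, y))) * Cpower (eps, y) (- a))))%C).
    { intros y. unfold f.
      replace (PI * INR (S p) * (eps, y))%C with (INR (S p) * (PI * (eps, y)))%C by ring.
      replace (PI * INR (S n) * (eps, y))%C with (INR (S n) * (PI * (eps, y)))%C by ring.
      rewrite Ccot_product by (rewrite 1?Nat.gcd_comm; auto).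
      assert (E : forall q b, Csum (fun m => b m * cot_power a (INR m / INR (S q)) (eps, y))%C 1 q
        = (Cpower (eps, y) (- a) * Csum (fun m => b m * Ccot (PI * (eps, y) - root_arg q m)) 1 q)%C).
      { intros q b. rewrite <- Csum_mult_l. apply Csum_ext. intros m _. unfold cot_power.
        replace (PI * ((eps, y) - (INR m / INR (S q))%R))%C with (PI * (eps, y) - root_arg q m)%C; [ring|].
        unfold root_arg, Rdiv. rewrite !RtoC_mult. ring. }
      rewrite !E. unfold Cdiv. rewrite <- Cpower_opp. ring. }
    apply has_symmetric_integral_plus; apply has_symmetric_integral_plus.
    - apply has_symmetric_integral_scal. now apply Cpower_integral.
    - apply has_symmetric_integral_scal, has_symmetric_integral_Csum. intros m Hm.
      apply has_symmetric_integral_scal, cot_power_has_integral; auto.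
    - apply has_symmetric_integral_scal, has_symmetric_integral_Csum. intros m Hm.
      apply has_symmetric_integral_scal, cot_power_has_integral; auto.
    - apply has_symmetric_integral_scal, csc_power_integral; auto. }
  (* On the line both cotangents are bounded uniformly in y. With kappa = 0 the whole exponent tau =
     Re a > 1 goes into the decay in y. *)
  set (K := / Rabs (sin (PI * (INR (S p) * eps))) * / Rabs (sin (PI * (INR (S n) * eps)))
     * (power_const a * Rpower eps (- 0) * Rpower (Rmin eps 1 / 2) (- Re a))).
  destruct (is_RInt_gen_decay (vline_integrand f eps) K (Re a) ha) as [l [Hgen Hl]].
  - apply Rmult_le_pos.
    + apply Rmult_le_pos; left; now apply Rinv_0_lt_compat, Rabs_pos_lt.
    + apply Rmult_le_pos; [apply Rmult_le_pos|]; left; apply exp_pos.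
  - intros y. apply (ccontinuous_vertical (fun z => Ci * f z)%C).
    apply ccontinuous_mult; [apply ccontinuous_const|]. unfold f, Cdiv.
    apply ccontinuous_mult; [apply ccontinuous_mult|].
    + apply ccontinuous_Ccot; [rewrite Harg; apply Csin_neq0; now left|].
      apply ccontinuous_mult; [apply ccontinuous_const|apply ccontinuous_id].
    + apply ccontinuous_Ccot; [rewrite Harg; apply Csin_neq0; now left|].
      apply ccontinuous_mult; [apply ccontinuous_const|apply ccontinuous_id].
    + apply ccontinuous_Cinv; [apply Cpower_neq0|now apply ccontinuous_Cpower].
  - intros y. unfold vline_integrand, f, Cdiv. rewrite <- Cpower_opp, !Cmod_mult, Cmod_Ci, Rmult_1_l.
    unfold K. rewrite (Rmult_assoc (_ * _) _ (decay_rate _ _)).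
    apply Rmult_le_compat; [apply Rmult_le_pos; apply Cmod_ge_0|apply Cmod_ge_0| |].
    + apply Rmult_le_compat; try apply Cmod_ge_0; rewrite Harg; now apply Cmod_Ccot_le.
    + apply Cmod_Cpower_decay; lra.
  - split; [exists l; exact Hgen|].
    assert (El : vline_int f eps = l).
    { exact (RInt_gen_unique_C _ _ Hgen). }
    (* The improper integral [l] and the value found by partial fractions are both limits of the
       same symmetric integrals. *)
    rewrite El, (tends_unique _ _ _ Hl (proj2 Hint)).
    set (Zn := Csum (fun m => Ccot (PI * INR m * INR (S p) / INR (S n))%R * hurwitz_zeta (- - a) (INR m / INR (S n))%R)%C 1 (S n - 1)).
    set (Zp := Csum (fun m => Ccot (PI * INR m * INR (S n) / INR (S p))%R * hurwitz_zeta (- - a) (INR m / INR (S p))%R)%C 1 (S p - 1)).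
    assert (B1 : bettin_conrey (- a) (S p) (S n) = (Cpower (INR (S n)) (- a) * Zn)%C) by reflexivity.
    assert (B2 : bettin_conrey (- a) (S n) (S p) = (Cpower (INR (S p)) (- a) * Zp)%C) by reflexivity.
    rewrite B1, B2.
    (* Matches the form of [bettin_conrey] at b = -a: its zeta argument is [- - a], and its sum ends
       at [S q - 1], which is q. *)
    assert (E : forall q r, Csum (fun m => Ccot (INR (S r) * root_arg q m)%R * (- 2 * hurwitz_zeta a (INR m / INR (S q))%R))%C 1 q
      = (- 2 * Csum (fun m => Ccot (PI * INR m * INR (S r) / INR (S q))%R * hurwitz_zeta (- - a) (INR m / INR (S q))%R) 1 (S q - 1))%C).
    { intros q r. rewrite <- Csum_mult_l. replace (S q - 1)%nat with q by lia. apply Csum_ext. intros m _.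
      replace (- - a)%C with a by ring.
      replace (INR (S r) * root_arg q m) with (PI * INR m * INR (S r) / INR (S q)); [ring|].
      unfold root_arg. field. apply not_0_INR. lia. }
    unfold Sn, Sp. rewrite !E. fold Zn Zp.
    (* Every power is expressed through h, k, h^a and k^a, after which the identity is one of
       fractions. *)
    rewrite !Cpower_Rmult by assumption. unfold Cminus. rewrite !Cpower_plus, !Cpower_opp, !Cpower_1 by assumption.
    field. repeat split; auto using Cpower_neq0, Ci_neq0.
Qed.
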